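(* Fix $m\ge2$ and a face $F$ of the Kunz cone $C_m$. Let $\mathcal M=\{x_i:1\le i\le m-1\}\cup\{y^{b_{i,j}}:1\le i,j\le m-1\}$ be a set of formal symbols. There exists a sequence of matrices $N_1,N_2,\dots$, whose entries are $\Bbbk$-linear combinations of formal products of elements of $\mathcal M$ (and which depend only on $m$ and $F$), with the following property: for every numerical semigroup $S$ of multiplicity $m$ whose Apéry coordinate vector lies in the relative interior of $F$, substituting the variables $x_i\in R$, $y=x_0$, and the values $b_{i,j}$ computed from $S$ into the entries of the $N_d$ yields the differentials of a graded minimal free resolution of $R/J_S$ (with $N_1$ presenting generators of $J_S$). In particular, the ranks of the free modules and the positions of the nonzero entries of the differentials in this minimal resolution depend only on $m$ and $F$.
   Context: A numerical semigroup is a submonoid $S\subseteq(\mathbb Z_{\ge0},+)$ containing $0$ with finite complement; its multiplicity is $m=\min(S\setminus\{0\})$. Its Apéry set is $\{n\in S:n-m\notin S\}=\{0,a_1,\dots,a_{m-1}\}$ with $a_i\equiv i\pmod m$, $a_0:=m$, and its Apéry coordinate vector is $(a_1,\dots,a_{m-1})$. Subscripts are mod $m$ in $\{0,\dots,m-1\}$. For $1\le i,j\le m-1$: $c_{i,j}=\frac1m(a_i+a_j-a_{i+j})$, $b_{i,j}=c_{i,j}$ if $i+j\not\equiv0$, $b_{i,j}=c_{i,j}+1$ if $i+j\equiv0\pmod m$. The Kunz cone $C_m\subseteq\mathbb R_{\ge0}^{m-1}$ is defined by $z_i+z_j\ge z_{i+j}$ for $1\le i\le j\le m-1$, $i+j\ne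 m$. $R=\Bbbk[x_0,\dots,x_{m-1}]$ over a field $\Bbbk$, graded by $\deg x_i=a_i$, $y=x_0$. The Apéry toric ideal is $J_S=\ker(R\to\Bbbk[t],\ x_i\mapsto t^{a_i})$. *)

(* Defs.v *)
From HB Require Import structures.
From mathcomp Require Import all_boot all_order all_algebra.
From mathcomp Require Import finmap multinomials.mpoly.
Set Implicit Arguments. Unset Strict Implicit. Unset Printing Implicit Defensive.
Import Order.TTheory GRing.Theory Num.Theory.
Local Open Scope ring_scope.

Definition numerical_semigroup (S : pred nat) : Prop :=
  [/\ 0%N \in S,
      (forall x y, x \in S -> y \in S -> (x + y)%N \in S)
    & exists N : nat, forall x, (N <= x)%N -> x \in S].

Definition multiplicity (S : pred nat) (m : nat) : Prop :=
  [/\ (0 < m)%N, m \in S & forall x, (0 < x < m)%N -> x \notin S].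

(* a i (1 <= i <= m-1) is the element of the Apery set
   Ap(S) = {n in S : n - m notin S} (integer subtraction) with a i = i mod m. *)
Definition apery_coords (S : pred nat) (m : nat) (a : nat -> nat) : Prop :=
  forall i, (1 <= i <= m.-1)%N ->
    [/\ a i \in S, (a i %% m)%N = i & ~~ ((m <= a i)%N && ((a i - m)%N \in S))].

Definition ap (m : nat) (a : nat -> nat) (i : nat) : nat :=
  if (i %% m)%N == 0%N then m else a i.

(* c_{i,j} = (a_i + a_j - a_{i+j})/m  (subscripts mod m);
   this is a nonnegative integer, so nat arithmetic is exact. *)
Definition ccoef (m : nat) (a : nat -> nat) (i j : nat) : nat :=
  ((ap m a i + ap m a j - ap m a ((i + j) %% m)%N) %/ m)%N.

Definition bcoef (m : nat) (a : nat -> nat) (i j : nat) : nat :=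
  (ccoef m a i j + (if ((i + j) %% m)%N == 0%N then 1 else 0))%N.

Section Cone.
Variable R : realFieldType.

(* A vector z : 'rV_(m-1) has coordinates z_1, ..., z_{m-1};
   zc z i is z_i (and 0 if i is out of range). *)
Definition zc (n : nat) (z : 'rV[R]_n) (i : nat) : R :=
  \sum_(j < n | j.+1 == i) z 0 j.

Definition dotr (n : nat) (c z : 'rV[R]_n) : R := \sum_(j < n) c 0 j * z 0 j.

Definition kunz_cone (m : nat) (z : 'rV[R]_(m.-1)) : Prop :=
  (forall j, 0 <= z 0 j) /\
  (forall i j : nat, (1 <= i)%N -> (i <= j)%N -> (j <= m.-1)%N -> (i + j != m)%N ->
     zc z ((i + j) %% m)%N <= zc z i + zc z j).

Definition kunz_face (m : nat) (F : 'rV[R]_(m.-1) -> Prop) : Prop :=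
  exists c : 'rV[R]_(m.-1),
    (forall z, kunz_cone z -> 0 <= dotr c z) /\
    (forall z, F z <-> (kunz_cone z /\ dotr c z = 0)).

Definition relint (n : nat) (F : 'rV[R]_n -> Prop) (z : 'rV[R]_n) : Prop :=
  F z /\ forall y, F y -> exists2 e : R, 0 < e & F (z + e *: (z - y)).

Definition apery_vec (m : nat) (a : nat -> nat) : 'rV[R]_(m.-1) :=
  \row_(j < m.-1) (a j.+1)%:R.
End Cone.

Section Res.
Variable k : fieldType.

Definition xv (m i : nat) : {mpoly k[m]} :=
  if insub i is Some j then 'X_j else 0.

(* Formal symbols M: for n = m-1, symbol number v < n is x_{v+1};
   symbol number n + p*n + q (p, q < n) is y^{b_{p+1,q+1}}.
   The ring of k-linear combinations of formal products of symbols is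
   the polynomial ring k[M] = {mpoly k[n + n*n]}. *)
Definition formal_ring (m : nat) := {mpoly k[m.-1 + m.-1 * m.-1]}.

Definition symval (m : nat) (a : nat -> nat) (v : nat) : {mpoly k[m]} :=
  let n := m.-1 in
  if (v < n)%N then xv m v.+1
  else let w := (v - n)%N in
       xv m 0 ^+ bcoef m a (w %/ n)%N.+1 (w %% n)%N.+1.

Definition subst (m : nat) (a : nat -> nat) (T : formal_ring m) : {mpoly k[m]} :=
  mmap (fun c : k => c%:MP) (fun v : 'I_(m.-1 + m.-1 * m.-1) => symval m a v) T.

Definition apery_ideal (m : nat) (a : nat -> nat) : pred {mpoly k[m]} :=
  fun p => mmap (fun c : k => c%:P) (fun i : 'I_m => 'X^(ap m a i)) p == 0.

Definition wdeg (m : nat) (w : nat -> nat) (mon : 'X_{1..m}) : nat :=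
  (\sum_(i < m) w i * mon i)%N.

(* ... -> R^{r 2} --M 1--> R^{r 1} --M 0--> R^{r 0} = R -> R/J -> 0,
   with row-vector convention (u |-> u *m M d), is a graded minimal free
   resolution of R/J, where R = k[x_0..x_{m-1}] is graded by deg x_i = w i. *)
Definition graded_minimal_free_resolution (m : nat) (w : nat -> nat)
    (J : pred {mpoly k[m]}) (r : nat -> nat)
    (M : forall d : nat, 'M[{mpoly k[m]}]_(r d.+1, r d)) : Prop :=
  [/\ r 0 = 1%N,
      (forall p, p \in J <-> exists u : 'rV_(r 1%N), u *m M 0%N = const_mx p),
      (forall d (u : 'rV_(r d.+1)),
          u *m M d = 0 <-> exists v : 'rV_(r d.+2), u = v *m M d.+1),
      (* minimality: all entries lie in the homogeneous maximal ideal *)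
      (forall d i j, mcoeff 0%MM (M d i j) = 0)
    & (* gradedness: free modules with degree shifts, homogeneous maps of degree 0 *)
      exists sh : forall d : nat, 'I_(r d) -> nat,
        (forall j, sh 0%N j = 0%N) /\
        (forall d i j (mon : 'X_{1..m}), mon \in msupp (M d i j) ->
            (sh d j + wdeg w mon)%N = sh d.+1 i)].
End Res.

(* Main.v *)
Require Import Defs.
From HB Require Import structures.
From mathcomp Require Import all_boot all_order all_algebra.
From mathcomp Require Import finmap multinomials.mpoly.
From mathcomp Require Import ring lra zify.
From Stdlib Require Import Classical.
Set Implicit Arguments. Unset Strict Implicit. Unset Printing Implicit Defensive.
Import Order.TTheory GRing.Theory Num.Theory.
Local Open Scope ring_scope.

(* Over k[y] the algebra R/J_S is free on e_0, ..., e_(m-1), with x_i e_s = y^b e_(i+s) for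
   b = b_(i,s) (b = 0 when s = 0).  Writing X_i for these commuting multiplication operators,
   the Koszul complex of the operators x_i - X_i on R^m is a finite graded free resolution of
   R/J_S whose entries are x_i, y^b and scalars, hence uniform in S; it is not minimal, since
   some entries are units.  Fix one S_0 in the relative interior of F (if there is none, the
   claim is vacuous).  All S in the relative interior of F have the same pairs with
   b_(i,j) = 0, so the corresponding symbols can be replaced by 1.  The S_0-degrees of all
   remaining symbols are positive, so a homogeneous formal entry with nonzero constant term
   is a scalar, and it can be cancelled by Gaussian elimination, which preserves exactness
   and homogeneity for all S simultaneously.  After finitely many cancellations no entry has
   a constant term, and the specialized resolutions are minimal. *)

(** * Koszul complexes *)

Section Koszul.
Variables (R : comNzRingType) (q : nat).
Implicit Types (th : nat -> 'M[R]_q).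

Fixpoint ksize (q j : nat) : nat :=
  if j is j'.+1 then (ksize q j' + ksize q j')%N else q.

Fixpoint kdiag (j : nat) (B : 'M[R]_q) : 'M[R]_(ksize q j) :=
  if j is j'.+1 then block_mx (kdiag j' B) 0 0 (kdiag j' B) else B.

(** Koszul differential of [th 0], ..., [th j.-1] on row vectors, with all exterior degrees in one
    square matrix. At each stage the second half of the indices stands for the basis elements that
    contain the operator just added. *)
Fixpoint kdiff th (j : nat) : 'M[R]_(ksize q j) :=
  if j is j'.+1
  then block_mx (kdiff th j') 0 (kdiag j' (th j')) (- kdiff th j') else 0.

(** Projection onto exterior degree 0; [kinj] is the matching inclusion. *)
Fixpoint kproj (j : nat) : 'M[R]_(ksize q j, q) :=
  if j is j'.+1 then col_mx (kproj j') 0 else 1%:M.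

Fixpoint kinj (j : nat) : 'M[R]_(q, ksize q j) :=
  if j is j'.+1 then row_mx (kinj j') 0 else 1%:M.

Definition in_span th (j : nat) (v : 'rV[R]_q) : Prop :=
  exists w : nat -> 'rV[R]_q, v = \sum_(i < j) w i *m th i.

Lemma in_span0 th j : in_span th j 0.
Proof. by exists (fun=> 0); rewrite big1 // => i _; rewrite mul0mx. Qed.

Lemma in_spanB th j u v : in_span th j u -> in_span th j v -> in_span th j (u - v).
Proof.
move=> [w1 ->] [w2 ->]; exists (fun i => w1 i - w2 i).
by rewrite -sumrB; apply: eq_bigr => i _; rewrite mulmxBl.
Qed.

Lemma in_spanN th j u : in_span th j u -> in_span th j (- u).
Proof. by move=> h; rewrite -sub0r; apply: in_spanB => //; apply: in_span0. Qed.

Lemma in_spanS th j v :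
  in_span th j.+1 v <-> exists v' w, in_span th j v' /\ v = v' + w *m th j.
Proof.
split=> [[w ->]|[v' [w [[w' ->] ->]]]].
  by exists (\sum_(i < j) w i *m th i), (w j); split; [exists w|rewrite big_ord_recr].
exists (fun i => if (i < j)%N then w' i else w).
rewrite big_ord_recr /= ltnn; congr (_ + _).
by apply: eq_bigr => i _; rewrite ltn_ord.
Qed.

Lemma kdiag_proj j B : kdiag j B *m kproj j = kproj j *m B.
Proof.
elim: j => [|j IH] /=; first by rewrite mulmx1 mul1mx.
by rewrite mul_block_col mul_col_mx IH !mulmx0 !mul0mx !addr0.
Qed.

Lemma kinj_proj j : kinj j *m kproj j = 1%:M.
Proof.
by elim: j => [|j IH] /=; rewrite ?mulmx1 // mul_row_col IH mulmx0 addr0.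
Qed.

Lemma kinj_diff th j : kinj j *m kdiff th j = 0.
Proof.
elim: j => [|j IH] /=; first by rewrite mulmx0.
by rewrite mul_row_block IH !mulmx0 !mul0mx !addr0 row_mx0.
Qed.

Lemma kdiag_comm j B C : comm_mx B C -> comm_mx (kdiag j B) (kdiag j C).
Proof.
rewrite /comm_mx => h; elim: j => [|j IH] //=.
by rewrite !mulmx_block IH !mulmx0 !mul0mx !addr0 !add0r.
Qed.

(** Such a [B] acts as a chain map, so each stage of the Koszul complex is the mapping cone of the
    next operator on the previous stage. *)
Lemma kdiff_diag th j B : (forall i, (i < j)%N -> comm_mx (th i) B) ->
  comm_mx (kdiff th j) (kdiag j B).
Proof.
rewrite /comm_mx; elim: j => [|j IH] h /=; first by rewrite mulmx0 mul0mx.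
have {}IH := IH (fun i ij => h i (ltnW ij)).
by rewrite !mulmx_block !mulNmx !mulmxN IH (kdiag_comm j (h j _)) //
  ?mulmx0 ?mul0mx ?oppr0 ?addr0 ?add0r.
Qed.

Lemma kdiff_proj th j v : in_span th j (v *m kdiff th j *m kproj j).
Proof.
elim: j v => [|j IH] v /=; first by rewrite mulmx0 mul0mx; apply: in_span0.
rewrite -[v]hsubmxK mul_row_block mul_row_col !mulmx0 !addr0.
apply/in_spanS; exists (lsubmx v *m kdiff th j *m kproj j), (rsubmx v *m kproj j).
by split; [exact: IH | rewrite mulmxDl -!mulmxA kdiag_proj].
Qed.

Variables (th : nat -> 'M[R]_q) (n : nat).
Hypothesis th_comm : forall i j, (i < n)%N -> (j < n)%N -> comm_mx (th i) (th j).
Hypothesis th_reg : forall j v, (j < n)%N ->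
  in_span th j (v *m th j) -> in_span th j v.

Lemma kdiff_sq j : (j <= n)%N -> kdiff th j *m kdiff th j = 0.
Proof.
elim: j => [|j IH] jn /=; first by rewrite mulmx0.
have dc : comm_mx (kdiff th j) (kdiag j (th j)).
  by apply: kdiff_diag => i ij; apply: th_comm => //; apply: ltn_trans jn.
rewrite mulmx_block !mulNmx !mulmxN -dc subrr IH; last exact: ltnW.
by rewrite ?(mulmx0, mul0mx) !oppr0 !addr0 block_mx0.
Qed.

(** One equivalence covers all exterior degrees: the span condition concerns degree 0 only, so in
    positive degrees it says that cycles are boundaries. Induction along the mapping cones, with
    regularity of the next operator. *)
Lemma kdiff_exact j u : (j <= n)%N ->
  (u *m kdiff th j = 0 /\ in_span th j (u *m kproj j)) <->
  exists v, u = v *m kdiff th j.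
Proof.
move=> jn; split; last first.
  by move=> [v ->]; split; [rewrite -mulmxA kdiff_sq // mulmx0 | exact: kdiff_proj].
elim: j u jn => [|j IH] u jn /=.
  by rewrite mulmx1 => -[_ [w ->]]; exists 0; rewrite big_ord0 mul0mx.
rewrite -[u]hsubmxK; move: (lsubmx u) (rsubmx u) => u0 u1.
rewrite mul_row_block mul_row_col !mulmx0 add0r addr0 mulmxN => -[h hs].
have dc : comm_mx (kdiff th j) (kdiag j (th j)).
  by apply: kdiff_diag => i ij; apply: th_comm => //; apply: ltn_trans jn.
have h0 : u0 *m kdiff th j + u1 *m kdiag j (th j) = 0.
  by move/(congr1 lsubmx): h; rewrite row_mxKl linear0.
have h1 : u1 *m kdiff th j = 0.
  by move/(congr1 rsubmx): h; rewrite row_mxKr linear0 => /eqP; rewrite oppr_eq0 => /eqP.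
have {}jn' := ltnW jn.
(* The degree 0 component of [u1], multiplied by [th j], is minus that of a boundary, so regularity
   places the component itself in the span. *)
have [v1 e1] : exists v, u1 = v *m kdiff th j.
  apply: IH => //; split=> //; apply: th_reg => //.
  rewrite -mulmxA -kdiag_proj mulmxA.
  move/eqP: h0; rewrite addrC addr_eq0 => /eqP ->.
  by rewrite mulNmx; apply/in_spanN/kdiff_proj.
move/in_spanS: hs => [v' [w [hv' e0]]].
(* Degree 0 correction: subtracting its product with [th j] leaves exactly [v'] in degree 0, and
   since [x] is a cycle it can be added to the second half without changing [u1]. *)
pose x := (w + v1 *m kproj j) *m kinj j.
have xd : x *m kdiff th j = 0 by rewrite -mulmxA kinj_diff mulmx0.
have [v0 ev0] : exists v, u0 + v1 *m kdiag j (th j) - x *m kdiag j (th j) = v *m kdiff th j.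
  apply: IH => //; split.
    rewrite mulmxBl mulmxDl -!mulmxA -dc !mulmxA -e1 h0 xd mul0mx subr0 //.
  suff -> : (u0 + v1 *m kdiag j (th j) - x *m kdiag j (th j)) *m kproj j = v' by [].
  rewrite mulmxBl mulmxDl e0 -!mulmxA kdiag_proj !mulmxA /x.
  rewrite -[(w + _) *m kinj j *m _]mulmxA kinj_proj mulmx1 mulmxDl.
  by rewrite -(addrA v') addrK.
exists (row_mx v0 (x - v1)).
rewrite mul_row_block mulmx0 add0r mulmxN mulmxBl mulmxBl xd sub0r opprK -e1 -ev0.
by congr row_mx; rewrite addrA subrK addrK.
Qed.

End Koszul.

(** * Multiplication operators on the free module with basis [e_s] *)

Section ShiftMatrix.
Variables (R : comNzRingType) (n : nat).

(** For [i < n] this index names both the variable [x_(i+1)] and the residue [i+1]; addition in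
    ['I_n.+1] is modulo [n.+1]. *)
Definition shvar (i : nat) : 'I_n.+1 := inord i.+1.

(** Row [s] is [x_i e_s - X_i e_s], where [X_i] sends [e_s] to [b i s] times the shifted basis
    vector. *)
Definition shift_mx (x : nat -> R) (b : nat -> 'I_n.+1 -> R) (i : nat) : 'M[R]_n.+1 :=
  \matrix_(s, s') (x i *+ (s' == s) - b i s *+ (s' == s + shvar i)).

Variables (x : nat -> R) (b : nat -> 'I_n.+1 -> R).
Let th := shift_mx x b.

Lemma mul_shift_mx (v : 'rV[R]_n.+1) i s :
  (v *m th i) 0 s = v 0 s * x i - v 0 (s - shvar i) * b i (s - shvar i).
Proof.
rewrite mxE; under eq_bigr => t _ do rewrite mxE mulrBr !mulrnAr.
rewrite sumrB; congr (_ - _).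
  rewrite (bigD1 s) //= eqxx big1 ?addr0 // => t ts.
  by rewrite eq_sym (negbTE ts) mulr0n.
rewrite (bigD1 (s - shvar i)) //= subrK eqxx big1 ?addr0 // => t ts.
by rewrite -subr_eq eq_sym (negbTE ts) mulr0n.
Qed.

Lemma shift_mx_comm i j :
  (forall s, b i s * b j (s + shvar i) = b j s * b i (s + shvar j)) ->
  comm_mx (th i) (th j).
Proof.
move=> b_cocycle.
apply/row_matrixP => r; rewrite !rowE !mulmxA.
move: (delta_mx 0 r : 'rV[R]_n.+1) => v; apply/rowP => s; rewrite !mul_shift_mx.
(* Only the terms coming from this index, shifted twice to reach [s], depend on the order of the two
   operators. *)
have := b_cocycle (s - shvar i - shvar j).
rewrite subrK addrAC subrK [s - shvar j - shvar i]addrAC => e.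
by ring: e.
Qed.

End ShiftMatrix.

(** * The Koszul resolution of the Apery algebra *)

Section Division.
Variables (k : fieldType) (n : nat) (B : nat -> 'I_n.+1 -> nat).
Local Notation P := {mpoly k[n.+1]}.
Local Notation var := (shvar n).

Definition apery_th : nat -> 'M[P]_n.+1 :=
  shift_mx (fun i => 'X_(var i)) (fun i s => 'X_ord0 ^+ B i s).
Local Notation th := apery_th.

Definition free_of (L : pred 'I_n.+1) (v : 'rV[P]_n.+1) : Prop :=
  forall s (mu : 'X_{1..n.+1}), mu \in msupp (v 0 s) -> forall l, L l -> mu l = 0%N.

Lemma shvar_neq0 i : (i < n)%N -> var i != ord0.
Proof. by move=> lin; rewrite -val_eqE /= inordK. Qed.

Lemma free_of_coef L v s (mu : 'X_{1..n.+1}) l : free_of L v -> L l -> mu l != 0%N -> (v 0 s)@_mu = 0.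
Proof.
move=> h Ll /eqP mul; apply: memN_msupp_eq0; apply/negP => /h /(_ l Ll) //.
Qed.

Lemma free_ofD L u v : free_of L u -> free_of L v -> free_of L (u + v).
Proof.
move=> hu hv s mu; rewrite mxE => /msuppD_le; rewrite mem_cat.
by case/orP; [apply: hu | apply: hv].
Qed.

Lemma free_of0 L : free_of L 0.
Proof. by move=> s mu; rewrite mxE msupp0. Qed.

Lemma free_ofN L v : free_of L v -> free_of L (- v).
Proof. by move=> h s mu; rewrite mxE (perm_mem (msuppN _)); apply: h. Qed.

Lemma delta_apery_th i s (p : P) :
  (p *: delta_mx 0 s : 'rV_n.+1) *m th i =
  (p * 'X_(var i)) *: delta_mx 0 s - (p * 'X_ord0 ^+ B i s) *: delta_mx 0 (s + var i).
Proof.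
apply/rowP => t; rewrite mul_shift_mx !mxE /=; congr (_ - _); first exact: mulrAC.
rewrite subr_eq; case: eqVneq => [->|_]; last by rewrite !mulr0 mul0r.
by rewrite addrK mulrAC.
Qed.

(** Modulo [th i], one factor [var i] on [e_s] can be traded for a power of [y] on the shifted basis
    vector. This lowers the exponent of [var i] by one and brings in only [y], which lies outside
    [L]. *)
Lemma division_monomial L i : (i < n)%N -> ~~ L ord0 ->
  forall (K : nat) (mu : 'X_{1..n.+1}) s (c : k), mu (var i) = K -> (forall l, L l -> mu l = 0%N) ->
  exists w r, (c *: 'X_[mu]) *: delta_mx 0 s = w *m th i + r /\
    free_of (predU1 (var i) L) r.
Proof.
move=> lin L0; elim=> [|K IH] mu s c muK Lmu.
  exists 0, ((c *: 'X_[mu]) *: delta_mx 0 s); split; first by rewrite mul0mx add0r.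
  move=> t nu; rewrite !mxE /=; case: eqP => _; rewrite ?mulr0 ?msupp0 // mulr1.
  move=> /msuppZ_le; rewrite msuppX inE => /eqP -> l /orP[/eqP ->|] //.
  exact: Lmu.
pose nu := (mu - U_(var i))%MM.
have emu : mu = (nu + U_(var i))%MM.
  rewrite /nu submK //; apply/mnm_lepP => l; rewrite mnm1E.
  by case: eqP => // <-; rewrite muK.
have /(_ (nu + U_(ord0) *+ B i s)%MM (s + var i) c) [] := IH.
- rewrite mnmDE mulmnE mnm1E eq_sym (negbTE (shvar_neq0 lin)) mul0n addn0.
  by move: muK; rewrite emu mnmDE mnm1E eqxx addn1 => -[].
- move=> l Ll; rewrite mnmDE mulmnE mnm1E; case: eqP => [e|_].
    by rewrite e Ll in L0.
  have := Lmu l Ll; rewrite emu mnmDE => /eqP; rewrite addn_eq0 => /andP[/eqP -> _].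
  by rewrite mul0n.
move=> w [r [e fr]]; exists ((c *: 'X_[nu]) *: delta_mx 0 s + w), r; split=> //.
rewrite mulmxDl -addrA -e delta_apery_th {1}emu mpolyXD scalerAl -addrA.
by rewrite [X in _ + X](_ : _ = 0) ?addr0 // addrC mpolyXD -mpolyXn scalerAl subrr.
Qed.

Lemma division L i v : (i < n)%N -> ~~ L ord0 -> free_of L v ->
  exists w r, v = w *m th i + r /\ free_of (predU1 (var i) L) r.
Proof.
move=> lin L0 fv; pose G v := exists w r, v = w *m th i + r /\ free_of (predU1 (var i) L) r.
have GD u u' : G u -> G u' -> G (u + u').
  move=> [w [r [-> fr]]] [w' [r' [-> fr']]]; exists (w + w'), (r + r'); split.
    by rewrite mulmxDl addrACA.
  exact: free_ofD.
have G0 : G 0 by exists 0, 0; rewrite mul0mx addr0; split=> //; apply: free_of0.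
rewrite [v]row_sum_delta; apply: (big_ind G) => // s _.
rewrite [v 0 s]mpolyE scaler_suml big_seq; apply: (big_ind G) => // mu mus.
by apply: (division_monomial lin L0 _ _ (erefl _)) => l; apply: (fv _ _ mus).
Qed.

(** In [z *m th i] the diagonal term raises the exponent of [var i] by one and the shift term keeps
    it. Comparing coefficients expresses each coefficient of [z] by one of higher exponent, so
    descending induction applies. *)
Lemma apery_th_inj i z : (i < n)%N -> free_of (pred1 (var i)) (z *m th i) -> z = 0.
Proof.
(* [K0] is at least the size of every entry, so coefficients with exponent of [var i] at least [K0]
   vanish; [d] measures how far below [K0] the exponent may be. *)
move=> lin fz; pose K0 := (\sum_s msize (z ord0 s))%N.
suff H d : forall s (mu : 'X_{1..n.+1}), (K0 <= mu (var i) + d)%N -> (z 0 s)@_mu = 0.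
  apply/rowP => s; rewrite mxE; apply/mpolyP => mu; rewrite mcoeff0.
  by apply: (H K0); rewrite leq_addl.
elim: d => [|d IH] s mu.
  rewrite addn0 => hK; apply: memN_msupp_eq0; apply: msize_mdeg_ge.
  apply: leq_trans (leq_trans hK _); first by rewrite /K0 (bigD1 s) //= leq_addr.
  by rewrite mdegE (bigD1 (var i)) //= leq_addr.
move=> hK; have := @free_of_coef _ _ s (U_(var i) + mu)%MM (var i) fz (eqxx _).
rewrite mnmDE mnm1E eqxx => /(_ isT); rewrite mul_shift_mx mcoeffB mcoeffMX.
move=> /eqP; rewrite subr_eq0 => /eqP ->.
apply: memN_msupp_eq0; rewrite mpolyXn (perm_mem (msuppMX _ _)).
apply/mapP => -[nu nus e].
have : (z 0 (s - var i))@_nu = 0.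
  apply: IH; have /mnmP/(_ (var i)) := e; rewrite !mnmDE mulmnE !mnm1E eqxx.
  by rewrite eq_sym (negbTE (shvar_neq0 lin)) mul0n add0n => <-; rewrite add1n addSnnS.
by move/eqP; rewrite mcoeff_eq0 nus.
Qed.

Definition first_vars (j : nat) : pred 'I_n.+1 := fun l => (0 < l <= j)%N.

Lemma first_varsS j : (j < n)%N -> first_vars j.+1 =1 predU1 (var j) (first_vars j).
Proof.
move=> jn l; rewrite /= -val_eqE /= inordK // /first_vars [(l <= j.+1)%N]leq_eqVlt ltnS.
by case: (nat_of_ord l) => [|l'] /=.
Qed.

(** Existence of normal forms: divide by [th 0], [th 1], ... in turn; each remainder stays free of
    the variables removed before. *)
Lemma span_decomp j v : (j <= n)%N ->
  exists r, in_span th j (v - r) /\ free_of (first_vars j) r.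
Proof.
elim: j => [|j IH] jn.
  exists v; split; first by rewrite subrr; apply: in_span0.
  by move=> s mu _ l; rewrite /first_vars; case: (nat_of_ord l).
have [r [h fr]] := IH (ltnW jn).
have [w [r' [e fr']]] := @division _ _ _ jn (erefl : ~~ first_vars j ord0) fr.
exists r'; split; last by move=> s mu h' l; rewrite first_varsS //; apply: fr' h' l.
apply/in_spanS; exists (v - r), w; split=> //.
by rewrite [in RHS]e opprD addrA [RHS]addrAC subrK.
Qed.

Lemma free_of_th L i r : ~~ L ord0 -> ~~ L (var i) -> free_of L r -> free_of L (r *m th i).
Proof.
move=> L0 Li fr s mu; rewrite mul_shift_mx mpolyXn.
have aux t (nu : 'X_{1..n.+1}) : (forall l, L l -> nu l = 0%N) ->
    mu \in msupp (r 0 t * 'X_[nu]) -> forall l, L l -> mu l = 0%N.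
  move=> hnu; rewrite (perm_mem (msuppMX _ _)) => /mapP[mu' h ->] l Ll.
  by rewrite mnmDE hnu // (fr _ _ h).
move=> /msuppB_le; rewrite mem_cat => /orP[]; apply: aux => l Ll.
  by rewrite mnm1E; case: eqP => // e; rewrite e Ll in Li.
by rewrite mulmnE mnm1E; case: eqP => // e; rewrite e Ll in L0.
Qed.

Hypothesis B_cocycle : forall i j s, (i < n)%N -> (j < n)%N ->
  (B i s + B j (s + var i)%R = B j s + B i (s + var j)%R)%N.

Lemma apery_th_comm i j : (i < n)%N -> (j < n)%N -> comm_mx (th i) (th j).
Proof. by move=> lin ljn; apply: shift_mx_comm => s; rewrite -!exprD B_cocycle. Qed.

(** Uniqueness of normal forms, by peeling off the last operator. *)
Lemma span_free_eq0 j r : (j <= n)%N ->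
  in_span th j r -> free_of (first_vars j) r -> r = 0.
Proof.
elim: j r => [|j IH] r jn; first by move=> [w ->] _; rewrite big_ord0.
move=> /in_spanS [u [w [hu ->]]] fr.
(* Dividing each coefficient of [u] by [th j] and commuting the operators splits off a multiple of
   [th j]; what remains is in the smaller span and free of [var j]. *)
pose G v := exists z v', [/\ v = v' + z *m th j, in_span th j v' & free_of (pred1 (var j)) v'].
have [z [u' [eu su fu]]] : G u.
  case: hu => wu ->; apply: big_rec; first by exists 0, 0; split;
    rewrite ?mul0mx ?addr0 //; [apply: in_span0|apply: free_of0].
  move=> i _ _ [z [v' [-> sv fv]]].
  have f0 : free_of pred0 (wu i) by [].
  have [w' [r' [-> fr']]] := @division _ _ _ jn (erefl : ~~ @pred0 'I_n.+1 ord0) f0.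
  exists (w' *m th i + z), (r' *m th i + v'); split.
  - by rewrite !mulmxDl -!mulmxA (apery_th_comm jn (ltn_trans (ltn_ord i) jn)) [X in X + _ = _]addrC addrACA.
  - rewrite -[r' *m th i]opprK addrC; apply: in_spanB => //; apply: in_spanN.
    exists (fun i' => if i' == i :> nat then r' else 0); rewrite (bigD1 i) //= eqxx big1 ?addr0 // => i' ne.
    by rewrite ifN ?mul0mx.
  - apply: free_ofD => //; apply: free_of_th.
    + by rewrite /= eq_sym shvar_neq0.
    + rewrite /= -val_eqE /= !inordK ?ltnS //; last exact: ltn_trans (ltn_ord i) jn.
      by rewrite eqSS; apply: contraTN (ltn_ord i) => /eqP ->; rewrite ltnn.
    + by move=> s mu h l /eqP ->; apply: (fr' _ _ h); rewrite /= eqxx.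
have ez : z + w = 0.
  apply: (@apery_th_inj j) => //; rewrite mulmxDl.
  have -> : z *m th j + w *m th j = (u + w *m th j) - u'.
    by rewrite eu -(addrA u') [RHS]addrAC subrr add0r.
  apply: free_ofD; last exact: free_ofN.
  by move=> s mu h l /eqP ->; apply: (fr _ _ h); rewrite first_varsS //= eqxx.
have e : u + w *m th j = u' by rewrite eu -addrA -mulmxDl ez mul0mx addr0.
rewrite e; apply: IH => //; first exact: ltnW.
by rewrite -e => s mu h l hl; apply: (fr _ _ h); rewrite first_varsS //= hl orbT.
Qed.

(** Replace [v] by its normal form [r]. Since [th j] brings in only [y] and [var j], the product
    [r *m th j] is again a normal form; lying in the span, it is zero, and injectivity gives
    [r = 0]. *)
Lemma apery_th_reg j v : (j < n)%N ->
  in_span th j (v *m th j) -> in_span th j v.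
Proof.
move=> jn h; have [r [hr fr]] := span_decomp v (ltnW jn).
suff r0 : r = 0 by rewrite r0 subr0 in hr.
apply: (@apery_th_inj j) => //.
have -> : r *m th j = 0.
  apply: (span_free_eq0 (ltnW jn)); last first.
    apply: free_of_th => //; rewrite /first_vars /= inordK //; first by rewrite ltnn.
  have -> : r *m th j = v *m th j - (v - r) *m th j by rewrite mulmxBl opprB addrC subrK.
  apply: in_spanB => //; case: hr => w ->; exists (fun i => w i *m th j).
  by rewrite mulmx_suml; apply: eq_bigr => i _; rewrite -!mulmxA (apery_th_comm jn (ltn_trans (ltn_ord i) jn)).
exact: free_of0.
Qed.
End Division.

(** * The augmentation to [k[t]] and its kernel *)

Section AperyAlgebra.
Variables (k : fieldType) (n : nat) (a : nat -> nat) (B : nat -> 'I_n.+1 -> nat).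
Local Notation P := {mpoly k[n.+1]}.
Local Notation var := (shvar n).
Local Notation th := (apery_th k B).

(** Degree of [e_s], which stands for [t^(a_s)]. It is 0 for the unit [e_0], in contrast to the
    convention [a_0 = m] for the variable [y]. *)
Definition basis_wt (s : 'I_n.+1) : nat := if s == 0 then 0%N else a s.
Local Notation w := basis_wt.

Hypothesis a_mod : forall s : 'I_n.+1, s != 0 -> (a s %% n.+1)%N = s.
Hypothesis B_wt : forall i s, (i < n)%N ->
  (a (var i) + w s = n.+1 * B i s + w (s + var i)%R)%N.

Definition apery_eval : P -> {poly k} :=
  mmap (fun c : k => c%:P) (fun i : 'I_n.+1 => 'X^(ap n.+1 a i)).
Local Notation phi := apery_eval.

HB.instance Definition _ := GRing.RMorphism.on phi.

Lemma apery_evalX i : phi 'X_i = 'X^(ap n.+1 a i).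
Proof. by rewrite /phi mmapX mmap1U. Qed.

Lemma ap_ord0 : ap n.+1 a (@ord0 n) = n.+1.
Proof. by rewrite /ap mod0n. Qed.

Lemma ap_var i : (i < n)%N -> ap n.+1 a (var i) = a (var i).
Proof.
by move=> lin; rewrite /ap inordK ?ltnS // modn_small ?ltnS.
Qed.

(** After multiplication by [m] both sides telescope to the same weight difference between [e_s] and
    its double shift, plus [a_(i+1) + a_(j+1)]. *)
Lemma B_cocycle i j s : (i < n)%N -> (j < n)%N ->
  (B i s + B j (s + var i)%R = B j s + B i (s + var j)%R)%N.
Proof.
move=> lin ljn; apply/eqP; rewrite -(eqn_pmul2l (ltn0Sn n)) !mulnDr.
rewrite -(eqn_add2r (w (s + var i + var j))); apply/eqP.
have e1 := B_wt s lin; have e2 := B_wt s ljn.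
have e3 := B_wt (s + var i) ljn; have e4 := B_wt (s + var j) lin.
rewrite [s + var j + var i]addrAC in e4.
move: e1 e2 e3 e4; move: (w s) (w (s + var i)) (w (s + var j)) (w (s + var i + var j)).
move: (n.+1 * _)%N (n.+1 * _)%N (n.+1 * _)%N (n.+1 * _)%N (a _) (a _).
lia.
Qed.

Definition apery_aug (v : 'rV[P]_n.+1) : {poly k} := \sum_s phi (v 0 s) * 'X^(w s).
Local Notation eps := apery_aug.

Lemma apery_augB u v : eps (u - v) = eps u - eps v.
Proof.
by rewrite /eps -sumrB; apply: eq_bigr => s _; rewrite !mxE rmorphB mulrBl.
Qed.

Lemma apery_aug_th i v : (i < n)%N -> eps (v *m th i) = 0.
Proof.
move=> lin; rewrite /eps; under eq_bigr => s _ do rewrite mul_shift_mx rmorphB mulrBl.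
rewrite sumrB; apply/eqP; rewrite subr_eq0; apply/eqP.
rewrite [RHS](reindex_inj (addIr (var i))) /=; apply: eq_bigr => s _.
rewrite addrK !rmorphM rmorphXn /= !apery_evalX ap_ord0 ap_var // -!mulrA -exprM -!exprD.
by rewrite B_wt.
Qed.

Lemma apery_aug_span v : in_span th n v -> eps v = 0.
Proof.
case=> u ->; apply: (big_ind (fun v => eps v = 0)).
- by rewrite /eps big1 // => s _; rewrite mxE rmorph0 mul0r.
- move=> x y hx hy; rewrite -[y]opprK apery_augB hx -sub0r apery_augB hy.
  by rewrite subr0 sub0r /eps big1 ?oppr0 // => s _; rewrite mxE rmorph0 mul0r.
- by move=> i _; apply: apery_aug_th.
Qed.

(** The entries of [r] involve only [y], and [y^d e_s] maps to [t^(m d + w s)]. The residue of the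
    exponent modulo [m] recovers [s], then the quotient recovers [d], so no two terms cancel. *)
Lemma free_of_aug_eq0 r : free_of (@first_vars n n) r -> eps r = 0 -> r = 0.
Proof.
move=> fr er; apply/rowP => s; rewrite mxE; apply/mpolyP => mu; rewrite mcoeff0.
apply/eqP; rewrite mcoeff_eq0; apply/negP => mus.
have w_mod t : (w t %% n.+1)%N = t.
  by rewrite /w; case: eqVneq => [->|]; [rewrite mod0n | apply: a_mod].
have wt t (nu : 'X_{1..n.+1}) : nu \in msupp (r 0 t) ->
    mmap1 (fun i : 'I_n.+1 => 'X^(ap n.+1 a i) : {poly k}) nu = 'X^(n.+1 * nu ord0).
  move=> nut; rewrite /mmap1 big_ord_recl /= ap_ord0 -exprM big1 ?mulr1 // => i _.
  by rewrite (fr _ _ nut) ?expr0 // /first_vars /= /bump add1n.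
have := congr1 (fun p : {poly k} => p`_(n.+1 * mu ord0 + w s)) er.
rewrite coef0 /eps coef_sum (bigD1 s) //= [X in _ + X]big1 ?addr0; last first.
  move=> t ts; rewrite /phi /mmap mulr_suml coef_sum big_seq big1 // => nu nut.
  rewrite (wt _ _ nut) -mulrA -exprD coefCM coefXn; case: eqP; rewrite ?mulr0 //.
  move/(congr1 (modn^~ n.+1)); rewrite ![(n.+1 * _)%N]mulnC !modnMDl !w_mod => /val_inj e.
  by rewrite e eqxx in ts.
rewrite /phi /mmap mulr_suml coef_sum (bigD1_seq mu) ?msupp_uniq //=.
rewrite big_seq_cond big1 ?addr0; last first.
  move=> nu /andP[nut nu_mu]; rewrite (wt _ _ nut) -mulrA -exprD coefCM coefXn.
  case: eqP; rewrite ?mulr0 // => /addIn/eqP; rewrite eqn_pmul2l // => /eqP e.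
  case/eqP: nu_mu; apply/mnmP => l; case: (unliftP ord0 l) => [l' ->|-> //].
  have hl : first_vars n (lift ord0 l') by rewrite /first_vars /= /bump add1n ltn_ord.
  by rewrite (fr _ _ nut) ?(fr _ _ mus).
rewrite (wt _ _ mus) -mulrA -exprD coefCM coefXn eqxx mulr1 => /eqP.
by rewrite mcoeff_eq0 mus.
Qed.

Lemma apery_augP v : in_span th n v <-> eps v = 0.
Proof.
split; first exact: apery_aug_span.
move=> ev; have [r [hr fr]] := span_decomp B v (leqnn n).
suff r0 : r = 0 by rewrite r0 subr0 in hr.
apply: free_of_aug_eq0 => //.
by have := apery_aug_span hr; rewrite apery_augB ev sub0r => /eqP; rewrite oppr_eq0 => /eqP.
Qed.

Lemma apery_koszul_exact u :
  (u *m kdiff th n = 0 /\ eps (u *m kproj P n.+1 n) = 0) <->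
  exists v, u = v *m kdiff th n.
Proof.
rewrite -apery_augP; apply: kdiff_exact (leqnn n).
- by move=> i j lin ljn; apply: apery_th_comm => // *; apply: B_cocycle.
- by move=> j v; apply: apery_th_reg => *; apply: B_cocycle.
Qed.

End AperyAlgebra.

(** * Gaussian elimination in an exact complex *)

Section Elimination.
Variables (R C : comNzRingType) (phi : {rmorphism R -> C}) (N : nat) (eps : 'I_N -> C).

(** [A] holds the surviving basis elements; the index type stays fixed while [A] shrinks, so
    cancellations need no reindexing. *)
Definition exact_on (A : {set 'I_N}) (D : 'M[R]_N) : Prop :=
  forall u : 'I_N -> R,
    ((forall j, j \in A -> \sum_(i in A) u i * D i j = 0) /\
     \sum_(i in A) phi (u i) * eps i = 0) <->
    exists v : 'I_N -> R, forall j, j \in A -> u j = \sum_(i in A) v i * D i j.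

(** For [c] inverse to [D p q], this is the Schur complement of the pivot. *)
Definition elim_mx (T : comNzRingType) (D : 'M[T]_N) (p q : 'I_N) (c : T) : 'M[T]_N :=
  \matrix_(i, j) (D i j - D i q * c * D p j).

Variables (A : {set 'I_N}) (D : 'M[R]_N) (p q : 'I_N) (c : R).
Hypotheses (pA : p \in A) (qA : q \in A) (pq : p != q) (cD : c * D p q = 1).
Hypotheses (Dpp : D p p = 0) (Dqq : D q q = 0) (eps_p : eps p = 0).
Let A' := A :\ p :\ q.
Let D' := elim_mx D p q c.

Lemma sum_pivot (V : zmodType) (F : 'I_N -> V) :
  \sum_(i in A) F i = F p + F q + \sum_(i in A') F i.
Proof. by rewrite (big_setD1 p) //= (big_setD1 q) ?addrA // !inE eq_sym pq. Qed.

Lemma sum_elim_mx (u : 'I_N -> R) j : \sum_(i in A') u i * D' i j =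
  \sum_(i in A') u i * D i j - (\sum_(i in A') u i * D i q) * c * D p j.
Proof.
rewrite !mulr_suml -sumrB; apply: eq_bigr => i _.
by rewrite mxE mulrBr !mulrA.
Qed.

(** Embeds the reduced complex in the original one: the coordinate at [p] is the one that makes the
    boundary vanish at [q]. *)
Let lift_vec (u : 'I_N -> R) (i : 'I_N) : R :=
  if i == p then - (\sum_(i in A') u i * D i q) * c
  else if i == q then 0 else u i.

Lemma lift_vecE u i : i \in A' -> lift_vec u i = u i.
Proof. by rewrite !inE /lift_vec => /and3P[/negbTE -> /negbTE ->]. Qed.

Lemma lift_vec_p u : lift_vec u p = - (\sum_(i in A') u i * D i q) * c.
Proof. by rewrite /lift_vec eqxx. Qed.

Lemma lift_vec_q u : lift_vec u q = 0.
Proof. by rewrite /lift_vec eq_sym (negbTE pq) eqxx. Qed.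

Lemma lift_vec_sum u j : \sum_(i in A) lift_vec u i * D i j = \sum_(i in A') u i * D' i j.
Proof.
rewrite sum_pivot sum_elim_mx lift_vec_p lift_vec_q mul0r addr0 addrC !mulNr.
by congr (_ - _); apply: eq_bigr => i /lift_vecE ->.
Qed.

Lemma lift_vec_sum_q u : \sum_(i in A) lift_vec u i * D i q = 0.
Proof. by rewrite lift_vec_sum sum_elim_mx -mulrA cD mulr1 subrr. Qed.

Hypothesis exD : exact_on A D.

Lemma exact_boundary v j : j \in A ->
  \sum_(i in A) (\sum_(l in A) v l * D l i) * D i j = 0.
Proof.
have [_ h] := exD (fun i => \sum_(l in A) v l * D l i).
by have [|h1 _] := h; [exists v | apply: h1].
Qed.

Lemma exact_boundary_aug v : \sum_(i in A) phi (\sum_(l in A) v l * D l i) * eps i = 0.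
Proof.
have [_ h] := exD (fun i => \sum_(l in A) v l * D l i).
by have [|_ h1] := h; [exists v | apply: h1].
Qed.

(* D^2 = 0 makes row q a combination of the remaining rows. *)
Lemma row_q_elim j : j \in A' -> D q j = - c * \sum_(i in A') D p i * D' i j.
Proof.
move=> jA; have jA' : j \in A by move: jA; rewrite !inE => /and3P[].
have row_p l : \sum_(i in A) (i == p)%:R * D i l = D p l.
  rewrite (bigD1 p) //= eqxx mul1r big1 ?addr0 // => i /andP[_ /negbTE ->].
  by rewrite mul0r.
have := exact_boundary (fun i => (i == p)%:R) qA.
under eq_bigr => i _ do rewrite row_p.
rewrite sum_pivot Dpp Dqq mul0r mulr0 !add0r => e0.
have := exact_boundary (fun i => (i == p)%:R) jA'.
under eq_bigr => i _ do rewrite row_p.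
rewrite sum_pivot Dpp mul0r add0r => /eqP; rewrite addr_eq0 => /eqP e1.
rewrite sum_elim_mx e0 !mul0r subr0 mulNr -mulrN -e1 mulrA cD mul1r //.
Qed.

Lemma exact_elim : exact_on A' D'.
Proof.
have subA j : j \in A' -> j \in A by rewrite !inE => /and3P[].
have split_A j : j \in A -> [\/ j = p, j = q | j \in A'].
  rewrite !inE => ->; case: (eqVneq j p) => [|_]; first by constructor 1.
  by case: (eqVneq j q) => [|_]; [constructor 2 | constructor 3].
move=> u; split=> [[hu hau]|[v hv]].
- pose U := lift_vec u.
  have UD j : j \in A' -> \sum_(i in A) U i * D i j = 0.
    by move=> jA; rewrite lift_vec_sum hu.
  (* [D^2 = 0] read in column [q] leaves only the pivot term, and the pivot is invertible. *)
  have UDp : \sum_(i in A) U i * D i p = 0.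
    have := exact_boundary U qA; rewrite sum_pivot Dqq mulr0 addr0 [X in _ + X]big1 ?addr0; last first.
      by move=> i /UD ->; rewrite mul0r.
    move/(congr1 (fun z => z * c)); rewrite mul0r -mulrA [_ * c]mulrC cD mulr1 //.
  have [v hv] : exists v : 'I_N -> R, forall j, j \in A -> U j = \sum_(i in A) v i * D i j.
    apply/exD; split=> [j /split_A [->|->|/UD]//|]; first exact: lift_vec_sum_q.
    rewrite sum_pivot eps_p mulr0 add0r /U lift_vec_q rmorph0 mul0r add0r.
    rewrite -[RHS]hau; apply: eq_bigr => i iA.
    by rewrite /U lift_vecE.
  (* The contribution of row [q] is rewritten by [row_q_elim] in rows of [D']; the subtracted term
     absorbs it. The coordinate [v p] is forced by the vanishing of [U] at [q]. *)
  exists (fun i => v i - v q * c * D p i) => j jA.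
  under eq_bigr => i _ do rewrite mulrBl.
  rewrite sumrB [X in _ - X](_ : _ = - (v q * D q j)); last first.
    rewrite row_q_elim // mulrA mulrN mulNr opprK mulr_sumr.
    by apply: eq_bigr => i _; rewrite mulrA.
  have e0 : 0 = v p * D p q + \sum_(i in A') v i * D i q.
    have := hv q qA; rewrite sum_pivot Dqq mulr0 addr0 => <-.
    by rewrite /U lift_vec_q.
  have e1 : v p = - (\sum_(i in A') v i * D i q) * c.
    move/eqP: e0; rewrite eq_sym addr_eq0 => /eqP <-.
    by rewrite -mulrA [_ * c]mulrC cD mulr1.
  have := hv j (subA _ jA); rewrite /U lift_vecE // => ->.
  by rewrite sum_pivot e1 sum_elim_mx; ring.
(* The boundary of [V] is [u] on [A'], zero at [q] and [w] at [p]. Column [q] of [D^2 = 0]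
   determines [w], and [eps p = 0] hides it from the augmentation. *)
- pose V := lift_vec v; pose w := \sum_(i in A) V i * D i p.
  have VD j : j \in A' -> \sum_(i in A) V i * D i j = u j.
    by move=> jA; rewrite lift_vec_sum hv.
  have bd j : j \in A -> w * D p j + \sum_(i in A') u i * D i j = 0.
    move=> /(exact_boundary V); rewrite sum_pivot -/w lift_vec_sum_q mul0r addr0 => e.
    by rewrite -[RHS]e; congr (_ + _); apply: eq_bigr => i /VD ->.
  split.
    move=> j /subA/bd e; rewrite sum_elim_mx.
    have := bd q qA => /eqP; rewrite addrC addr_eq0 => /eqP ->.
    by rewrite mulNr -[w * _ * c]mulrA [_ * c]mulrC cD mulr1 mulNr opprK addrC.
  have := exact_boundary_aug V.
  rewrite sum_pivot eps_p mulr0 add0r lift_vec_sum_q rmorph0 mul0r add0r => e.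
  by rewrite -[RHS]e; apply: eq_bigr => i /VD ->.
Qed.

End Elimination.

(** * Formal matrices and their specializations *)

Section KoszulIndices.
Variable q : nat.

(** Exterior degree of a Koszul basis element; [kbase] is its factor [e_s] and [kwt] its internal
    degree. *)
Fixpoint khom (j : nat) : 'I_(ksize q j) -> nat :=
  if j is j'.+1 then fun i => match split i with inl i' => khom i' | inr i' => (khom i').+1 end
  else fun=> 0%N.

Fixpoint kbase (j : nat) : 'I_(ksize q j) -> 'I_q :=
  if j is j'.+1 then fun i => match split i with inl i' => kbase i' | inr i' => kbase i' end
  else id.

Fixpoint kwt (w0 : 'I_q -> nat) (w : nat -> nat) (j : nat) : 'I_(ksize q j) -> nat :=
  if j is j'.+1
  then fun i => match split i with inl i' => kwt w0 w i' | inr i' => (w j' + kwt w0 w i')%N end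
  else w0.

Lemma khom0_inj j (i i' : 'I_(ksize q j)) :
  khom i = 0%N -> khom i' = 0%N -> kbase i = kbase i' -> i = i'.
Proof.
elim: j i i' => [|j IH] //= i i'.
case: (splitP i) => // l il; case: (splitP i') => // l' il' hl hl' e.
by apply/val_inj; rewrite /= il il' (IH _ _ hl hl' e).
Qed.

Lemma khom0_exists j (s : 'I_q) : exists i : 'I_(ksize q j), khom i = 0%N /\ kbase i = s.
Proof.
elim: j => [|j [i [hi bi]]]; first by exists s.
by exists (lshift _ i) => /=; rewrite (unsplitK (inl i)).
Qed.

Lemma kwt_khom0 w0 w j (i : 'I_(ksize q j)) : khom i = 0%N -> kwt w0 w i = w0 (kbase i).
Proof. by elim: j i => [|j IH] i //=; case: (split i) => // i' /IH. Qed.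

Lemma kproj_entry (R : comNzRingType) j (i : 'I_(ksize q j)) s :
  kproj R q j i s = ((khom i == 0%N) && (kbase i == s))%:R.
Proof.
elim: j i => [|j IH] i /=; first by rewrite mxE.
by rewrite mxE; case: (split i) => i'; rewrite ?IH ?mxE.
Qed.

Section Homogeneity.
Variables (k : fieldType) (N : nat).
Local Notation T := {mpoly k[N]}.
Variables (wt : 'X_{1..N} -> nat) (Z : 'X_{1..N} -> Prop).
Variables (w0 : 'I_q -> nat) (w : nat -> nat) (th : nat -> 'M[T]_q).

Lemma kdiag_homogeneous i (M : 'M[T]_q) j :
  (forall s s' mon, mon \in msupp (M s s') -> (w i + w0 s = w0 s' + wt mon)%N /\ Z mon) ->
  forall l l' mon, mon \in msupp (kdiag j M l l') ->
  [/\ khom l = khom l', (w i + kwt w0 w l = kwt w0 w l' + wt mon)%N & Z mon].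
Proof.
move=> hM; elim: j => [|j IH] l l' mon /=; first by case/hM.
rewrite !mxE; case: (split l) => i1; rewrite !mxE; case: (split l') => i2; rewrite ?mxE ?msupp0 //;
 by case/IH => -> e zm; split=> //; lia.
Qed.

(** [Z] is an arbitrary condition on monomials that travels with the weights; it is later
    instantiated by [relevant a]. *)
Lemma kdiff_homogeneous j :
  (forall i, (i < j)%N -> forall s s' mon, mon \in msupp (th i s s') ->
     (w i + w0 s = w0 s' + wt mon)%N /\ Z mon) ->
  forall l l' mon, mon \in msupp (kdiff th j l l') ->
  [/\ khom l = (khom l').+1, (kwt w0 w l = kwt w0 w l' + wt mon)%N & Z mon].
Proof.
elim: j => [|j IH] hth l l' mon /=; first by rewrite mxE msupp0.
have {}IH := IH (fun i ij => hth i (ltnW ij)).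
rewrite !mxE; case: (split l) => i1; rewrite !mxE; case: (split l') => i2; rewrite ?mxE ?msupp0 //.
- by case/IH.
- by case/(kdiag_homogeneous (hth j (leqnn _))) => -> e zm; split.
- by rewrite (perm_mem (msuppN _)) => /IH[-> -> zm]; split=> //; lia.
Qed.
End Homogeneity.

Lemma map_kdiag (R R' : comNzRingType) (f : {rmorphism R -> R'}) j (M : 'M[R]_q) :
  map_mx f (kdiag j M) = kdiag j (map_mx f M).
Proof. by elim: j => [|j IH] //=; rewrite map_block_mx !map_mx0 IH. Qed.

Lemma map_kdiff (R R' : comNzRingType) (f : {rmorphism R -> R'}) (th : nat -> 'M[R]_q) j :
  map_mx f (kdiff th j) = kdiff (fun i => map_mx f (th i)) j.
Proof.
elim: j => [|j IH] /=; first by rewrite map_mx0.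
by rewrite map_block_mx map_mx0 map_mxN IH map_kdiag.
Qed.

Lemma eq_kdiff (R : comNzRingType) (th th' : nat -> 'M[R]_q) j :
  (forall i, (i < j)%N -> th i = th' i) -> kdiff th j = kdiff th' j.
Proof.
elim: j => [|j IH] h //=.
by rewrite h // IH // => i ij; apply: h; apply: ltnW.
Qed.
End KoszulIndices.

(** * Apéry coordinates and the exponents [b] *)

Section AperyCoordinates.
Variables (S : pred nat) (n : nat) (a : nat -> nat).
Hypotheses (nsS : numerical_semigroup S) (mS : multiplicity S n.+1).
Hypothesis (aS : apery_coords S n.+1 a).

Lemma apery_coords_mod (s : 'I_n.+1) : s != 0 -> (a s %% n.+1)%N = s.
Proof.
move=> s0; have [] // := aS (i := s).
by rewrite lt0n -(inj_eq val_inj) /= in s0 *; rewrite s0 -ltnS ltn_ord.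
Qed.

(** If [x < a t], then [a t - m] is [x] plus a multiple of [m], hence in [S], against the Apéry
    condition. *)
Lemma apery_coords_le t x : (1 <= t <= n)%N -> x \in S -> (x %% n.+1)%N = t -> (a t <= x)%N.
Proof.
move=> ht xS xt; have [aSt amod /negP an] := aS ht.
have [_ addS _] := nsS; have [_ mSm _] := mS.
have mulS d : (x + d * n.+1)%N \in S.
  elim: d => [|d IH]; first by rewrite addn0.
  by rewrite mulSn addnCA; apply: addS.
rewrite leqNgt; apply/negP => lt; apply: an.
have [d ed] : exists d, (a t = x + d.+1 * n.+1)%N.
  have : (n.+1 %| a t - x)%N by rewrite -eqn_mod_dvd ?(ltnW lt) // amod xt.
  case/dvdnP => -[|d] e; last by exists d; rewrite -e subnKC // ltnW.
  by move/eqP: e; rewrite subn_eq0 leqNgt lt.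
have -> : (a t - n.+1 = x + d * n.+1)%N by rewrite ed mulSn addnCA addKn.
by rewrite mulS ed mulSn addnCA leq_addr.
Qed.

Definition apery_exponent (i : nat) (s : 'I_n.+1) : nat :=
  if s == 0 then 0%N else bcoef n.+1 a i.+1 s.

Lemma apery_exponent_wt i s : (i < n)%N ->
  (a (shvar n i) + basis_wt a s =
   n.+1 * apery_exponent i s + basis_wt a (s + shvar n i)%R)%N.
Proof.
move=> lin; have vi : shvar n i = i.+1 :> nat by rewrite /shvar inordK.
rewrite /apery_exponent /basis_wt; case: (eqVneq s 0) => [->|s0].
  rewrite add0r ifN ?muln0 ?addn0 ?add0n //.
  by rewrite -(inj_eq val_inj) /= vi.
have sn : (1 <= s <= n)%N.
  by rewrite lt0n -(inj_eq val_inj) /= in s0 *; rewrite s0 -ltnS ltn_ord.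
have [_ addS _] := nsS.
have [iS imod _] : [/\ a i.+1 \in S, (a i.+1 %% n.+1)%N = i.+1 & true].
  by have [] := aS (i := i.+1) lin.
have [sS smod _] : [/\ a s \in S, (a s %% n.+1)%N = s & true].
  by have [] := aS sn.
have xmod : ((a i.+1 + a s) %% n.+1)%N = (s + shvar n i)%R.
  by rewrite /= -modnDm imod smod vi addnC.
rewrite -(inj_eq val_inj) [X in _ == X]/= vi /bcoef /ccoef.
have -> : ((i.+1 + s) %% n.+1)%N = (s + shvar n i)%R by rewrite /= vi addnC.
have -> : ap n.+1 a i.+1 = a i.+1 by rewrite /ap modn_small.
have -> : ap n.+1 a s = a s.
  by rewrite /ap modn_small // ifN //; case/andP: sn; case: (nat_of_ord s).
move: (s + shvar n i)%R xmod => t xmod.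
(* In class 0, [ccoef] subtracts [a_0 = m] although [e_0] has weight 0; the extra 1 in [bcoef]
   compensates. *)
rewrite /ap modn_small //; case: eqP => t0.
  have m_dvd : (n.+1 %| a i.+1 + a s)%N by rewrite /dvdn xmod t0.
  have le_m : (n.+1 <= a i.+1 + a s)%N.
    by apply: dvdn_leq m_dvd; rewrite addn_gt0; move: imod; case: (a i.+1); rewrite ?mod0n.
  rewrite addn0 mulnDr muln1 mulnC divnK ?subnK //.
  by rewrite dvdn_subl.
(* Minimality of [a t] in its class makes the truncated subtraction exact. *)
have le_t : (a t <= a i.+1 + a s)%N.
  apply: apery_coords_le; [|exact: addS|exact: xmod].
  by rewrite lt0n -ltnS ltn_ord andbT; apply/eqP.
rewrite addn0 mulnC divnK ?subnK //.
rewrite -eqn_mod_dvd // xmod; apply/eqP/esym/apery_coords_mod.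
by rewrite -(inj_eq val_inj); apply/eqP.
Qed.
End AperyCoordinates.

(** * Vanishing exponents along a face of the Kunz cone *)

Section Faces.
Variables (R : realFieldType) (n : nat) (F : 'rV[R]_n.+1.-1 -> Prop).

Lemma zc_apery_vec a i : (0 < i <= n)%N -> zc (apery_vec R n.+1 a) i = (a i)%:R.
Proof.
case: i => // i /= lin; rewrite /zc (bigD1 (Ordinal lin)) //= mxE big1 ?addr0 // => j.
by rewrite -val_eqE /= eqSS => /andP[-> ].
Qed.

Lemma zc_lin (z y : 'rV[R]_n) e i : zc (z + e *: (z - y)) i = zc z i + e * (zc z i - zc y i).
Proof.
rewrite /zc -sumrB mulr_sumr -big_split; apply: eq_bigr => j _.
by rewrite !mxE.
Qed.

Lemma kunz_cone_le (z : 'rV[R]_n.+1.-1) i j : kunz_cone z ->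
  (0 < i <= n)%N -> (0 < j <= n)%N -> (i + j != n.+1)%N ->
  zc z ((i + j) %% n.+1)%N <= zc z i + zc z j.
Proof.
move=> [_ h] /andP[i0 lin] /andP[j0 ljn] ij.
case: (leqP i j) => [|/ltnW] le; first exact: h.
by rewrite addnC addrC; apply: h => //; rewrite addnC.
Qed.

(* Relative interior: a linear functional that is nonnegative on F and vanishes at one relative interior point vanishes on F. *)
Lemma apery_exponent_face S0 S a0 a i (s : 'I_n.+1) : kunz_face F ->
  numerical_semigroup S0 -> multiplicity S0 n.+1 -> apery_coords S0 n.+1 a0 ->
  numerical_semigroup S -> multiplicity S n.+1 -> apery_coords S n.+1 a ->
  relint F (apery_vec R n.+1 a0) -> F (apery_vec R n.+1 a) -> (i < n)%N ->
  apery_exponent a0 i s = 0%N -> apery_exponent a i s = 0%N.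
Proof.
move=> [c [_ hF]] ns0 m0 ap0 ns mS apS [_ rel] Fa lin e0.
have [s0|s0] := eqVneq s 0; first by rewrite /apery_exponent s0 eqxx.
have := apery_exponent_wt ns0 m0 ap0 s lin; have := apery_exponent_wt ns mS apS s lin.
rewrite e0 muln0 add0n /basis_wt (negbTE s0).
have vi : shvar n i = i.+1 :> nat by rewrite /shvar inordK.
have sn : (0 < s <= n)%N.
  by rewrite lt0n -(inj_eq val_inj) /= in s0 *; rewrite s0 -ltnS ltn_ord.
(* In class 0 a zero exponent would force [a0 i.+1 = 0], which has the wrong residue. *)
case: eqVneq => [_ _|t0].
  have [_ mod0 _] := ap0 i.+1 lin; rewrite vi => /eqP; rewrite addn_eq0 => /andP[/eqP a00 _].
  by rewrite a00 mod0n in mod0.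
have tn : (0 < (s + shvar n i)%R <= n)%N.
  by rewrite -[X in _ && X]ltnS ltn_ord andbT lt0n; exact: t0.
have ij : (i.+1 + s != n.+1)%N.
  apply: contra_neq t0 => e; apply/val_inj; by rewrite /= vi addnC e modnn.
have et : ((i.+1 + s) %% n.+1)%N = (s + shvar n i)%R by rewrite /= vi addnC.
move: (s + shvar n i)%R et tn {t0} => t et tn; rewrite vi => eS e1.
have hi : (0 < i.+1 <= n)%N := lin.
(* The Kunz inequality is an equality at [a0], so at this point beyond [a0], seen from [a], it
   reverses the inequality for [a]. *)
have [e egt0 /hF[kz _]] := rel _ Fa; have := kunz_cone_le kz hi sn ij.
rewrite et !zc_lin !zc_apery_vec // -e1 natrD => h.
have : (a i.+1)%:R + (a s)%:R <= (a t)%:R :> R.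
  rewrite -subr_le0 -(pmulr_rle0 _ egt0); lra.
rewrite -natrD ler_nat eS -[X in (_ <= X)%N]add0n leq_add2r leqn0 muln_eq0 /=.
by move/eqP.
Qed.
End Faces.

(** * Formal symbols, their weights and their specialization *)

Section FormalMatrices.
Variables (k : fieldType) (n : nat).
Local Notation m := n.+1.
Local Notation Nv := (n.+1.-1 + n.+1.-1 * n.+1.-1)%N.
Local Notation T := (formal_ring k n.+1).
Local Notation P := {mpoly k[n.+1]}.

Definition formal_var (v : nat) : T := if insub v is Some j then 'X_(j : 'I_Nv) else 0.

(** Symbol number [n + (i * n + s.-1)] is [y^b] with [b = b_(i+1,s)]; it is replaced by 1 when its
    exponent vanishes at the reference [a0]. *)
Definition formal_coef (a0 : nat -> nat) (i : nat) (s : 'I_n.+1) : T :=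
  if apery_exponent a0 i s == 0%N then 1 else formal_var (n + (i * n + s.-1)).

Definition formal_th (a0 : nat -> nat) : nat -> 'M[T]_n.+1 :=
  shift_mx formal_var (formal_coef a0).

Definition symval_mon (a : nat -> nat) (v : nat) : 'X_{1..n.+1} :=
  if (v < n)%N then U_(inord v.+1)%MM
  else (U_(ord0) *+ bcoef m a ((v - n) %/ n).+1 ((v - n) %% n).+1)%MM.

Definition subst_mon (a : nat -> nat) (mon : 'X_{1..Nv}) : 'X_{1..n.+1} :=
  (\sum_(v < Nv) symval_mon a v *+ mon v)%MM.

HB.instance Definition _ (a : nat -> nat) :=
  GRing.RMorphism.copy (@subst k n.+1 a)
    (mmap (@mpolyC n.+1 k) (fun v : 'I_Nv => symval k n.+1 a v)).

Lemma symvalE a v : symval k n.+1 a v = 'X_[symval_mon a v].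
Proof.
have xvE l (hl : (l < n.+1)%N) : xv k n.+1 l = 'X_(inord l).
  by rewrite /xv insubT /=; congr ('X_ _); apply/val_inj; rewrite /= inordK.
rewrite /symval /symval_mon /=; case: ifP => h; first by rewrite xvE.
by rewrite xvE // mpolyXn; congr ('X_[U_(_) *+ _]); apply/val_inj; rewrite /= inordK.
Qed.

Lemma subst_mpolyX a mon : subst a 'X_[mon] = 'X_[subst_mon a mon] :> P.
Proof.
rewrite /subst mmapX /mmap1 /subst_mon.
rewrite (big_morph (fun x : 'X_{1..n.+1} => 'X_[x] : P) (@mpolyXD _ _) (@mpolyX0 _ _)).
by apply: eq_bigr => v _; rewrite symvalE mpolyXn.
Qed.

Lemma subst_var a v : (v < n + n * n)%N -> subst a (formal_var v) = 'X_[symval_mon a v].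
Proof.
move=> hv; rewrite /formal_var insubT /= subst_mpolyX /subst_mon; congr ('X_[_]).
rewrite (bigD1 (Ordinal hv)) //= mnm1E eqxx mulm1n big1 ?addm0 // => w wv.
by rewrite mnm1E eq_sym (negbTE wv) mulm0n.
Qed.

(** Only an inclusion of supports: distinct formal monomials may have the same image and cancel. *)
Lemma subst_msupp a (p : T) nu : nu \in msupp (subst a p) ->
  exists2 mon, mon \in msupp p & nu = subst_mon a mon.
Proof.
rewrite {1}[p]mpolyE rmorph_sum /= => /msupp_sum_le /flattenP[l /mapP[mon]].
rewrite mem_filter /= => monp -> h; exists mon => //.
move: h; rewrite -mul_mpolyC rmorphM /= subst_mpolyX /subst mmapC mul_mpolyC.
by move/msuppZ_le; rewrite msuppX inE => /eqP.
Qed.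

Lemma subst_mon0 a : subst_mon a 0%MM = 0%MM.
Proof. by rewrite /subst_mon big1 // => v _; rewrite mnm0E mulm0n. Qed.

Lemma subst_monD a m1 m2 : subst_mon a (m1 + m2)%MM = (subst_mon a m1 + subst_mon a m2)%MM.
Proof.
apply/mnmP => l; rewrite mnmDE !mnm_sumE -big_split; apply: eq_bigr => v _.
by rewrite !mulmnE mnmDE mulnDr.
Qed.

Lemma subst_mon_eq0 a mon v : subst_mon a mon = 0%MM -> mon v != 0%N -> symval_mon a v = 0%MM.
Proof.
move=> e0 mv; apply/mnmP => l; rewrite mnm0E.
have /mnmP/(_ l) := e0; rewrite mnm0E /subst_mon mnm_sumE (bigD1 v) //= mulmnE.
move/eqP; rewrite addn_eq0 muln_eq0 (negbTE mv) orbF.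
by case/andP => /eqP.
Qed.

Lemma wdegD w (m1 m2 : 'X_{1..n.+1}) : wdeg w (m1 + m2)%MM = (wdeg w m1 + wdeg w m2)%N.
Proof. by rewrite /wdeg -big_split; apply: eq_bigr => i _; rewrite mnmDE mulnDr. Qed.

Lemma wdeg0 w : wdeg w (0%MM : 'X_{1..n.+1}) = 0%N.
Proof. by rewrite /wdeg big1 // => i _; rewrite mnm0E muln0. Qed.

Lemma wdegMn w (mu : 'X_{1..n.+1}) d : wdeg w (mu *+ d)%MM = (d * wdeg w mu)%N.
Proof.
by rewrite /wdeg big_distrr /=; apply: eq_bigr => i _; rewrite mulmnE [RHS]mulnC mulnA.
Qed.

Lemma wdeg1 (w : nat -> nat) (i : 'I_n.+1) : wdeg w U_(i)%MM = w i.
Proof.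
rewrite /wdeg (bigD1 i) //= mnm1E eqxx muln1 big1 ?addn0 // => j ji.
by rewrite mnm1E eq_sym (negbTE ji) muln0.
Qed.

Lemma wdeg_eq0 (w : nat -> nat) (mu : 'X_{1..n.+1}) :
  (forall i : 'I_n.+1, (0 < w i)%N) -> wdeg w mu = 0%N -> mu = 0%MM.
Proof.
move=> w0 /eqP; rewrite /wdeg sum_nat_eq0 => /forallP h; apply/mnmP => i.
by have := h i; rewrite muln_eq0 eqn0Ngt w0 mnm0E => /eqP.
Qed.

Definition formal_wt (a : nat -> nat) (mon : 'X_{1..Nv}) : nat :=
  wdeg (ap m a) (subst_mon a mon).

(** Excludes symbols that specialize to 1, so that a nontrivial formal monomial cannot become a
    constant. *)
Definition relevant (a : nat -> nat) (mon : 'X_{1..Nv}) : Prop :=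
  forall v, mon v != 0%N -> symval_mon a v <> 0%MM.

Lemma formal_wtU a v (hv : (v < Nv)%N) :
  formal_wt a U_(Ordinal hv)%MM = wdeg (ap m a) (symval_mon a v).
Proof.
have := @subst_var a v hv; rewrite /formal_var insubT /= subst_mpolyX => e.
by have /(congr1 (fun p : P => msupp p)) := e; rewrite !msuppX /formal_wt => -[->].
Qed.

Lemma coef_index_lt i (s : 'I_n.+1) : (i < n)%N -> (i * n + s.-1 < n * n)%N.
Proof.
move=> lin; have : (s.-1 < n)%N by have := ltn_ord s; lia.
nia.
Qed.

Lemma symval_mon_coef a i (s : 'I_n.+1) : (i < n)%N -> s != 0 ->
  symval_mon a (n + (i * n + s.-1)) = (U_(ord0) *+ apery_exponent a i s)%MM.
Proof.
move=> lin s0; rewrite /symval_mon ltnNge leq_addr /= addKn.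
have n0 : (0 < n)%N by apply: leq_ltn_trans lin.
have s0' : (0 < s)%N by rewrite lt0n -(inj_eq val_inj) /= in s0 *.
have sn : (s.-1 < n)%N by have := ltn_ord s; lia.
by rewrite divnMDl // divn_small // addn0 modnMDl modn_small // prednK // /apery_exponent (negbTE s0).
Qed.

(** The weight identity for [a] is homogeneity of [x_i - X_i]. The common zero pattern ensures that
    the symbols kept have positive exponent for [a]. *)
Lemma formal_th_homogeneous (a0 a : nat -> nat) i (s s' : 'I_n.+1) (mon : 'X_{1..Nv}) : (i < n)%N ->
  (forall s : 'I_n.+1, (a (shvar n i) + basis_wt a s =
     n.+1 * apery_exponent a i s + basis_wt a (s + shvar n i)%R)%N) ->
  (forall s : 'I_n.+1, apery_exponent a0 i s = 0%N <-> apery_exponent a i s = 0%N) ->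
  mon \in msupp (formal_th a0 i s s') ->
  (a (shvar n i) + basis_wt a s = basis_wt a s' + formal_wt a mon)%N /\ relevant a mon.
Proof.
move=> lin hwt h0; rewrite mxE => /msuppB_le; rewrite mem_cat => /orP[].
  case: eqP => [->|_]; rewrite ?mulr0n ?msupp0 // mulr1n.
  have iN : (i < Nv)%N by apply: ltn_addr.
  rewrite /formal_var insubT msuppX inE => /eqP ->; split.
    by rewrite formal_wtU /symval_mon lin wdeg1 ap_var // addnC.
  move=> v; rewrite mnm1E eqb0 negbK => /eqP <- /=.
  by rewrite /symval_mon lin => /eqP; rewrite -mdeg_eq0 mdeg1.
case: eqP => [->|_]; rewrite ?mulr0n ?msupp0 // mulr1n /formal_coef hwt.
case: eqP => [e|ne].
  rewrite msupp1 inE => /eqP ->; split; last by move=> v; rewrite mnm0E.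
  by rewrite (proj1 (h0 _)) // muln0 /formal_wt subst_mon0 wdeg0 addn0.
have s0 : s != 0 by apply/eqP => s0; apply: ne; rewrite s0 /apery_exponent eqxx.
have vN : (n + (i * n + s.-1) < Nv)%N by rewrite ltn_add2l coef_index_lt.
rewrite /formal_var insubT msuppX inE => /eqP ->; split.
  by rewrite formal_wtU symval_mon_coef // wdegMn wdeg1 ap_ord0 addnC mulnC.
move=> v; rewrite mnm1E eqb0 negbK => /eqP <- /=.
rewrite symval_mon_coef // => /mnmP/(_ ord0); rewrite mulmnE mnm1E eqxx mul1n mnm0E.
by move/h0.
Qed.

Lemma subst_formal_th a0 a i : (i < n)%N ->
  (forall s : 'I_n.+1, apery_exponent a0 i s = 0%N <-> apery_exponent a i s = 0%N) ->
  map_mx (@subst k n.+1 a) (formal_th a0 i) = apery_th k (@apery_exponent n a) i.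
Proof.
move=> lin h0; apply/matrixP => s s'; rewrite !mxE rmorphB !rmorphMn /=.
rewrite subst_var ?ltn_addr // {1}/symval_mon lin; congr (_ - _ *+ _).
rewrite /formal_coef; case: eqP => [/h0 ->|ne]; first by rewrite rmorph1 expr0.
have s0 : s != 0 by apply/eqP => s0; apply: ne; rewrite s0 /apery_exponent eqxx.
by rewrite subst_var ?ltn_add2l ?coef_index_lt // symval_mon_coef // mpolyXn.
Qed.

End FormalMatrices.

(** * The minimal resolution *)

Section GradedExactness.
Variables (R C : comNzRingType) (phi : {rmorphism R -> C}) (N : nat) (eps : 'I_N -> C).
Variables (A : {set 'I_N}) (D : 'M[R]_N) (h : 'I_N -> nat).
Hypothesis exD : exact_on phi eps A D.
Hypothesis hD : forall i j, D i j != 0 -> h i = (h j).+1.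
Hypothesis h_eps : forall i, h i != 0%N -> eps i = 0.

Definition degree_part (d : nat) : {set 'I_N} := [set i in A | h i == d].

Lemma exact_row_aug p : p \in A -> \sum_(i in A) phi (D p i) * eps i = 0.
Proof.
move=> pA; rewrite -[RHS](exact_boundary_aug exD (fun i => (i == p)%:R)).
apply: eq_bigr => i _; congr (phi _ * _).
rewrite (bigD1 p) //= eqxx mul1r big1 ?addr0 // => l /andP[_ /negbTE ->].
by rewrite mul0r.
Qed.

Lemma entry_eq0_degree i j : h i != (h j).+1 -> D i j = 0.
Proof. by move=> ij; apply: contraNeq ij => /hD ->. Qed.

Lemma sum_degree_part (V : zmodType) (F : 'I_N -> V) d :
  (forall i, i \in A -> h i != d -> F i = 0) ->
  \sum_(i in A) F i = \sum_(i in degree_part d) F i.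
Proof.
move=> F0; rewrite (big_setID (degree_part d)) /= [X in _ + X]big1 ?addr0.
  by apply: eq_bigl => i; rewrite !inE; case: (i \in A).
by move=> i; rewrite !inE => /andP[]; case: (boolP (i \in A)) => //= iA hi _; apply: F0.
Qed.

(** Extend [u] by zero to the whole complex; the augmentation condition then holds because [eps]
    lives in degree 0. *)
Lemma degree_exact d (u : 'I_N -> R) :
  (forall j, j \in degree_part d -> \sum_(i in degree_part d.+1) u i * D i j = 0) <->
  exists v : 'I_N -> R, forall j, j \in degree_part d.+1 ->
    u j = \sum_(i in degree_part d.+2) v i * D i j.
Proof.
have trunc e (f : 'I_N -> R) j :
    \sum_(i in A) (if h i == e then f i else 0) * D i j =
    \sum_(i in degree_part e) f i * D i j.
  rewrite (@sum_degree_part _ _ e) => [|i _ /negbTE ->]; last by rewrite mul0r.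
  by apply: eq_bigr => i; rewrite inE => /andP[_ ->].
have sumj e (f : 'I_N -> R) j : h j = e ->
    \sum_(i in A) f i * D i j = \sum_(i in degree_part e.+1) f i * D i j.
  by move=> <-; apply: sum_degree_part => i _ /entry_eq0_degree ->; rewrite mulr0.
have offj e (f : 'I_N -> R) j : h j != e ->
    \sum_(i in degree_part e.+1) f i * D i j = 0.
  move=> hj; rewrite big1 // => i; rewrite inE => /andP[_ /eqP hi].
  by rewrite entry_eq0_degree ?mulr0 // hi eqSS eq_sym.
pose u' i := if h i == d.+1 then u i else 0.
split=> [hu|[v hv]].
- have [v hv] : exists v : 'I_N -> R, forall j, j \in A -> u' j = \sum_(i in A) v i * D i j.
    apply/exD; split=> [j jA|].
      rewrite trunc; case: (eqVneq (h j) d) => [hj|/offj //].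
      by apply: hu; rewrite inE jA hj eqxx.
    rewrite big1 // => i _; rewrite /u'; case: eqP => [hi|_]; last by rewrite rmorph0 mul0r.
    by rewrite h_eps ?mulr0 // hi.
  exists v => j; rewrite inE => /andP[jA /eqP hj].
  by rewrite -(sumj _ v j hj) -hv // /u' hj eqxx.
- have [|hu' _] := (proj2 (exD u')).
    exists (fun i => if h i == d.+2 then v i else 0) => j jA; rewrite trunc /u'.
    by case: (eqVneq (h j) d.+1) => [hj|/offj -> //]; apply: hv; rewrite inE jA hj eqxx.
  by move=> j; rewrite inE => /andP[jA _]; rewrite -trunc; apply: hu'.
Qed.

(** Here the cycle condition is empty, since rows of degree 0 are zero. *)
Lemma degree0_exact (u : 'I_N -> R) :
  \sum_(i in degree_part 0) phi (u i) * eps i = 0 <->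
  exists v : 'I_N -> R, forall j, j \in degree_part 0 ->
    u j = \sum_(i in degree_part 1) v i * D i j.
Proof.
pose u' i := if h i == 0%N then u i else 0.
have aug_u : \sum_(i in A) phi (u' i) * eps i = \sum_(i in degree_part 0) phi (u i) * eps i.
  rewrite (@sum_degree_part _ _ 0) => [|i _ hi]; last by rewrite h_eps // mulr0.
  by apply: eq_bigr => i; rewrite inE /u' => /andP[_ ->].
have sumj (f : 'I_N -> R) j : h j = 0%N ->
    \sum_(i in A) f i * D i j = \sum_(i in degree_part 1) f i * D i j.
  by move=> hj; apply: sum_degree_part => i _ hi; rewrite entry_eq0_degree ?mulr0 // hj.
rewrite -aug_u; split=> [hu|[v hv]].
- have [v hv] : exists v : 'I_N -> R, forall j, j \in A -> u' j = \sum_(i in A) v i * D i j.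
    apply/exD; split=> // j jA; rewrite big1 // => i _; rewrite /u'.
    by case: eqP => [hi|_]; rewrite ?mul0r // entry_eq0_degree ?mulr0 // hi.
  exists v => j; rewrite inE => /andP[jA /eqP hj].
  by rewrite -(sumj v j hj) -hv // /u' hj.
- have [|_ ->] // := (proj2 (exD u')).
  exists (fun i => if h i == 1%N then v i else 0) => j jA; rewrite /u'.
  case: eqP => [hj|/eqP hj].
    rewrite (sumj _ _ hj) hv; last by rewrite inE jA hj.
    by apply: eq_bigr => i; rewrite inE => /andP[_ ->].
  rewrite big1 // => i _; case: eqP => [hi|_]; rewrite ?mul0r // entry_eq0_degree ?mulr0 // hi eqSS.
  by rewrite eq_sym.
Qed.
End GradedExactness.

(** * From index sets to matrices of the corresponding sizes *)

Section Submatrix.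
Variables (R : comNzRingType) (N : nat) (D : 'M[R]_N).

Definition set_mx (A B : {set 'I_N}) : 'M[R]_(#|A|, #|B|) :=
  \matrix_(i, j) D (enum_val i) (enum_val j).

Definition spread (A : {set 'I_N}) (u : 'rV[R]_#|A|) (i : 'I_N) : R :=
  \sum_l u 0 l *+ (enum_val l == i).

Lemma spread_enum_val (A : {set 'I_N}) (u : 'rV[R]_#|A|) l : spread u (enum_val l) = u 0 l.
Proof.
rewrite /spread (bigD1 l) //= eqxx big1 ?addr0 // => l' ll'.
by rewrite (inj_eq enum_val_inj) (negbTE ll').
Qed.

Lemma mul_set_mx (A B : {set 'I_N}) (u : 'rV[R]_#|A|) (f : 'I_N -> R) j :
  (forall l, u 0 l = f (enum_val l)) ->
  (u *m set_mx A B) 0 j = \sum_(i in A) f i * D i (enum_val j).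
Proof.
move=> uf; rewrite mxE [RHS]big_enum_val; apply: eq_bigr => l _.
by rewrite mxE uf.
Qed.

Lemma set_mx_exact (A B C : {set 'I_N}) :
  (forall f : 'I_N -> R, (forall j, j \in C -> \sum_(i in B) f i * D i j = 0) <->
     exists g : 'I_N -> R, forall j, j \in B -> f j = \sum_(i in A) g i * D i j) ->
  forall u : 'rV_#|B|, u *m set_mx B C = 0 <-> exists v : 'rV_#|A|, u = v *m set_mx A B.
Proof.
move=> ex u; split=> [u0|[v ->]].
  have [|g hg] := proj1 (ex (spread u)).
    move=> j jC; rewrite -(enum_rankK_in jC jC).
    rewrite -(@mul_set_mx _ _ u) ?u0 ?mxE // => l.
    by rewrite spread_enum_val.
  exists (\row_l g (enum_val l)); apply/rowP => l.
  rewrite (@mul_set_mx _ _ _ g) => [|l']; last by rewrite mxE.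
  by rewrite -hg ?enum_valP // spread_enum_val.
pose f j := \sum_(i in A) spread v i * D i j.
have h : forall j, j \in C -> \sum_(i in B) f i * D i j = 0.
  by apply: (proj2 (ex f)); exists (spread v).
apply/rowP => l; rewrite [RHS]mxE.
rewrite (@mul_set_mx _ _ _ f) => [|l'].
  by apply: h; apply: enum_valP.
by rewrite (@mul_set_mx _ _ _ (spread v)) // => i; rewrite spread_enum_val.
Qed.
End Submatrix.

(** * Cancelling scalars uniformly over the face *)

Section Minimization.
Variables (k : fieldType) (R : realFieldType) (n : nat) (F : 'rV[R]_n.+1.-1 -> Prop).
Local Notation m := n.+1.
Local Notation T := (formal_ring k n.+1).
Local Notation P := {mpoly k[n.+1]}.
Local Notation I := 'I_(ksize n.+1 n).

Definition apery_in_face (a : nat -> nat) : Prop :=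
  exists S, [/\ numerical_semigroup S, multiplicity S m, apery_coords S m a
               & relint F (apery_vec R m a)].

Hypothesis faceF : kunz_face F.
Variable a0 : nat -> nat.
Hypothesis a0F : apery_in_face a0.

Definition koszul_wt (a : nat -> nat) : I -> nat :=
  @kwt n.+1 (basis_wt a) (fun i => a (shvar n i)) n.

Definition koszul_aug (a : nat -> nat) (i : I) : {poly k} :=
  if khom i == 0%N then 'X^(basis_wt a (kbase i)) else 0.

Definition specialize (a : nat -> nat) (D : 'M[T]_(ksize n.+1 n)) : 'M[P]_(ksize n.+1 n) :=
  map_mx (@subst k n.+1 a) D.

(** Invariant of the cancellations: one formal [D] serves all [a] in the face at once. The last
    field keeps [e_0], which will be the sole generator in degree 0. *)
Record resolves (A : {set I}) (D : 'M[T]_(ksize n.+1 n)) : Prop := Resolves {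
  resolves_homogeneous : forall i j mon, mon \in msupp (D i j) -> khom i = (khom j).+1 /\
    forall a, apery_in_face a ->
      (koszul_wt a i = koszul_wt a j + formal_wt a mon)%N /\ relevant a mon;
  resolves_exact : forall a, apery_in_face a ->
    exact_on (@apery_eval k n a) (koszul_aug a) A (specialize a D);
  resolves_unit : exists2 e, e \in A & khom e = 0%N /\ kbase e = 0
}.

Lemma ap_gt0 a : apery_in_face a -> forall i : 'I_n.+1, (0 < ap m a i)%N.
Proof.
move=> [S [nsS mS apS _]] i; rewrite /ap modn_small //; case: eqP => // i0.
have : (a i %% n.+1)%N = i by apply: (apery_coords_mod apS); apply/eqP => e; apply: i0; rewrite e.
by case: (a i) => //; rewrite mod0n => /esym.
Qed.

Lemma apery_exponent_in_face a a' i s : apery_in_face a -> apery_in_face a' -> (i < n)%N ->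
  @apery_exponent n a i s = 0%N -> apery_exponent a' i s = 0%N.
Proof.
move=> [S [nsS mS apS rS]] [S' [nsS' mS' apS' [FS' _]]].
exact: (apery_exponent_face faceF nsS mS apS nsS' mS' apS' rS FS').
Qed.

Lemma koszul_resolves : resolves setT (kdiff (@formal_th k n a0) n).
Proof.
have sp a : apery_in_face a -> specialize a (kdiff (@formal_th k n a0) n) =
    kdiff (apery_th k (@apery_exponent n a)) n.
  move=> aF; rewrite /specialize map_kdiff; apply: eq_kdiff => i lin.
  by apply: subst_formal_th => // s; split; apply: apery_exponent_in_face.
split.
- move=> i j mon hmon.
  have hom a : apery_in_face a -> [/\ khom i = (khom j).+1,
      (koszul_wt a i = koszul_wt a j + formal_wt a mon)%N & relevant a mon].
    move=> aF; apply: kdiff_homogeneous hmon => l lin s s' mon'.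
    have [S [nsS mS apS _]] := aF; apply: formal_th_homogeneous => // t.
      exact: (apery_exponent_wt nsS mS apS t lin).
    by split; apply: apery_exponent_in_face.
  split; first by case: (hom _ a0F).
  by move=> a /hom[].
- move=> a aF; rewrite sp // => u; have [S [nsS mS apS _]] := aF.
  have := @apery_koszul_exact k n a (@apery_exponent n a) _ _ (\row_i u i).
  move=> /(_ (@apery_coords_mod _ _ _ apS)).
  move=> /(_ (fun i s lin => apery_exponent_wt nsS mS apS s lin)) ex.
  have augE : apery_aug a ((\row_i u i) *m kproj P n.+1 n) =
      \sum_(i in setT) apery_eval a (u i) * koszul_aug a i.
    rewrite /apery_aug; under eq_bigr => s _ do rewrite mxE rmorph_sum mulr_suml.
    rewrite exchange_big /=; apply: eq_big => [i|i _]; first by rewrite inE.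
    rewrite (bigD1 (kbase i)) //= big1 ?addr0 => [|s].
      rewrite mxE kproj_entry eqxx andbT /koszul_aug.
      by case: eqP => _; rewrite ?mulr1 ?mulr0 ?rmorph0 ?mul0r.
    by rewrite eq_sym kproj_entry => /negbTE ->; rewrite andbF mulr0 rmorph0 mul0r.
  have rowE (f : I -> P) (D : 'M[P]_(ksize n.+1 n)) j :
      ((\row_i f i) *m D) 0 j = \sum_(i in setT) f i * D i j.
    by rewrite mxE; apply: eq_big => [i|i _]; rewrite ?inE // mxE.
  rewrite -augE; split=> [[hu hau]|[v hv]].
    have [|v hv] := proj1 ex.
      by split=> //; apply/rowP => j; rewrite rowE hu ?mxE.
    exists (fun i => v 0 i) => j _; have /rowP/(_ j) := hv; rewrite mxE => ->.
    by rewrite mxE; apply: eq_bigl => i; rewrite inE.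
  have [|hu ->] := proj2 ex.
    by exists (\row_i v i); apply/rowP => j; rewrite rowE mxE hv.
  split=> // j _; have /rowP/(_ j) := hu.
  by rewrite rowE mxE.
- by have [e he] := khom0_exists n (0 : 'I_n.+1); exists e.
Qed.

Section Step.
Variables (A : {set I}) (D : 'M[T]_(ksize n.+1 n)).
Hypothesis resD : resolves A D.

Lemma specialize_khom a i j : khom i != (khom j).+1 -> specialize a D i j = 0.
Proof.
move=> hij; rewrite mxE (_ : D i j = 0) ?rmorph0 //; apply: msuppnil0.
case E : (msupp _) => [//|mon l].
have /(resolves_homogeneous resD)[e _] : mon \in msupp (D i j) by rewrite E mem_head.
by rewrite e eqxx in hij.
Qed.

(* The weights of a0 are positive on the monomials that occur, so homogeneity forces an entry with a constant term to be constant. *)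
Lemma pivot_constant p q : (D p q)@_0%MM != 0 -> D p q = ((D p q)@_0%MM)%:MP.
Proof.
rewrite -mcoeff_msupp => h0; apply/mpolyP => mon; rewrite mcoeffC.
case: (eqVneq mon 0%MM) => [->|mon0]; first by rewrite mulr1.
rewrite mulr0; apply: memN_msupp_eq0; apply: contra mon0 => hmon.
have [_ /(_ _ a0F) [e0 _]] := resolves_homogeneous resD h0.
have [_ /(_ _ a0F) [e1 rel]] := resolves_homogeneous resD hmon.
have wt0 : formal_wt a0 mon = 0%N.
  by apply/eqP; rewrite -(eqn_add2l (koszul_wt a0 q)) -e1 e0 /formal_wt subst_mon0 wdeg0.
have := wdeg_eq0 (ap_gt0 a0F) wt0 => s0.
apply/eqP/mnmP => v; rewrite mnm0E; apply/eqP/contraT => mv.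
by case: (rel v mv); apply: subst_mon_eq0 s0 mv.
Qed.

Lemma substC a (c : k) : subst a (c%:MP : T) = c%:MP.
Proof. exact: mmapC. Qed.

Lemma apery_evalC a (c : k) : @apery_eval k n a c%:MP = c%:P.
Proof. exact: mmapC. Qed.

Lemma specialize_hom a i j : specialize a D i j != 0 -> khom i = (khom j).+1.
Proof. by move=> D0; apply/eqP; apply: contraNT D0 => /specialize_khom ->. Qed.

(* The augmentation sends e_s to t^(a_s) and vanishes on row p, so its constant coefficient at e_0 is zero. *)
Lemma pivot_not_unit p q : p \in A -> q \in A -> (D p q)@_0%MM != 0 ->
  khom q = 0%N -> kbase q != 0.
Proof.
move=> pA qA c0 hq; apply: contraNneq c0 => bq.
have := exact_row_aug (resolves_exact resD a0F) pA.
move/(congr1 (fun f : {poly k} => f`_0)).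
rewrite coef_sum coef0 (bigD1 q) //= big1 ?addr0.
  have [//|c0] := eqVneq ((D p q)@_0%MM) 0.
  move: (pivot_constant c0); set c := (D p q)@_0%MM => Dpq.
  rewrite mxE Dpq substC apery_evalC /koszul_aug hq eqxx bq.
  by rewrite /basis_wt eqxx expr0 mulr1 coefC eqxx => c_eq0; case/eqP: c0.
move=> i /andP[iA iq]; rewrite coef0M /koszul_aug; case: eqP => hi; last by rewrite coef0 mulr0.
have bi : kbase i != 0.
  by apply: contraNneq iq => bi; apply/eqP/khom0_inj; rewrite ?hi ?hq ?bi ?bq.
have := ap_gt0 a0F (kbase i); rewrite coefXn /basis_wt (negbTE bi) /ap modn_small //.
rewrite ifN; last by [].
by move=> a_gt0; rewrite (ltn_eqF a_gt0) mulr0.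
Qed.

(** The pivot is a scalar, so one formal elimination specializes to an elimination for every [a]. *)
Lemma resolves_elim p q : p \in A -> q \in A -> (D p q)@_0%MM != 0 ->
  resolves (A :\ p :\ q) (elim_mx D p q ((D p q)@_0%MM)^-1%:MP).
Proof.
move=> pA qA c0; have pq0 : 0%MM \in msupp (D p q) by rewrite mcoeff_msupp.
have [hpq wpq] := resolves_homogeneous resD pq0.
have pq : p != q by apply: contra_eq_neq hpq => ->; rewrite neq_ltn ltnSn.
split.
- move=> i j mon; rewrite mxE => /msuppB_le; rewrite mem_cat => /orP[|].
    exact: (resolves_homogeneous resD).
  (* Degrees add up because the constant term at [(p, q)] has weight 0, which gives [p] and [q] the
     same internal degree. *)
  rewrite -mulrA mulrCA mul_mpolyC => /msuppZ_le /msuppM_le /allpairsP[[m1 m2]] /= [].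
  move=> /(resolves_homogeneous resD)[h1 w1] /(resolves_homogeneous resD)[h2 w2] ->.
  split; first by rewrite h1 -hpq h2.
  move=> a aF; have [e1 r1] := w1 a aF; have [e2 r2] := w2 a aF; have [e3 _] := wpq a aF.
  split.
    rewrite /formal_wt subst_monD wdegD e1 -/(formal_wt a m1) -/(formal_wt a m2).
    by move: e3 e2; rewrite /formal_wt subst_mon0 wdeg0 addn0 => -> ->; rewrite addnAC addnA.
  by move=> v; rewrite mnmDE addn_eq0 negb_and => /orP[/r1|/r2].
- move=> a aF.
  have -> : specialize a (elim_mx D p q ((D p q)@_0%MM)^-1%:MP) =
      elim_mx (specialize a D) p q ((D p q)@_0%MM)^-1%:MP.
    by apply/matrixP => i j; rewrite !mxE rmorphB !rmorphM /= substC.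
  apply: exact_elim => //.
  + by rewrite mxE (pivot_constant c0) substC mcoeffC eqxx mulr1 -mpolyCM mulVf.
  + by apply: specialize_khom; rewrite neq_ltn ltnSn.
  + by apply: specialize_khom; rewrite neq_ltn ltnSn.
  + by rewrite /koszul_aug hpq.
  + exact: resolves_exact.
- have [e eA [he be]] := resolves_unit resD; exists e => //.
  (* [e] differs from [q] by [pivot_not_unit], and from [p] because [p] has positive homological
     degree. *)
  rewrite !inE eA andbT; apply/andP; split; apply/eqP => e_eq.
    by have := pivot_not_unit pA qA c0; rewrite -e_eq he be eqxx => /(_ erefl).
  by rewrite -e_eq he in hpq.
Qed.
End Step.

Lemma minimal_resolves : exists A D, resolves A D /\
  forall p q, p \in A -> q \in A -> (D p q)@_0%MM = 0.
Proof.
have [d] := ubnP #|[set: I]|; have := koszul_resolves.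
move: setT (kdiff _ _) => A D; elim: d A D => // d IH A D resD cA.
case: (pickP [pred pq | [&& pq.1 \in A, pq.2 \in A & (D pq.1 pq.2)@_0%MM != 0]]) => [[p q]|h].
  move=> /= /and3P[pA qA c0]; apply: IH (resolves_elim resD pA qA c0) _.
  rewrite -ltnS; apply: leq_trans cA; rewrite ltnS.
  apply: leq_ltn_trans (subset_leq_card (subsetDl _ _)) _.
  by rewrite [in X in (_ < X)%N](cardsD1 p A) pA add1n.
exists A, D; split=> // p q pA qA; have := h (p, q); rewrite /= pA qA /=.
by move/negbFE/eqP.
Qed.

Section Resolution.
Variables (A : {set I}) (D : 'M[T]_(ksize n.+1 n)).
Hypothesis resD : resolves A D.
Hypothesis minD : forall p q, p \in A -> q \in A -> (D p q)@_0%MM = 0.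
Local Notation part := (degree_part A (@khom n.+1 n)).

(** A constant term after specialization comes from a formal monomial with trivial image; relevance
    makes that monomial trivial, and [minD] excludes it. *)
Lemma specialize_minimal a p q : apery_in_face a -> p \in A -> q \in A ->
  (specialize a D p q)@_0%MM = 0.
Proof.
move=> aF pA qA; rewrite mxE; apply: memN_msupp_eq0; apply/negP => /subst_msupp[mon hmon e0].
have [_ /(_ a aF) [_ rel]] := resolves_homogeneous resD hmon.
suff mon0 : mon = 0%MM.
  by move: hmon; rewrite mon0 mcoeff_msupp minD ?eqxx.
apply/mnmP => v; rewrite mnm0E; apply/eqP/contraT => mv.
by case: (rel v mv); apply: subst_mon_eq0 (esym e0) mv.
Qed.

Lemma koszul_aug_eq0 a i : @khom n.+1 n i != 0%N -> koszul_aug a i = 0.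
Proof. by rewrite /koszul_aug => /negbTE ->. Qed.

(* e_s - x_s e_0 is a cycle, hence a boundary; minimality forbids the coefficient 1 at e_s. *)
Lemma degree0_unit e :  e \in A -> khom e = 0%N -> kbase e = 0 -> part 0%N = [set e].
Proof.
move=> eA he be; apply/setP => i; rewrite !inE.
apply/andP/eqP => [[iA /eqP hi]|->]; last by rewrite eA he.
apply/eqP/contraT => ie.
have bi : kbase i != 0.
  by apply: contraNneq ie => bi; apply/eqP/khom0_inj; rewrite ?hi ?he ?bi ?be.
pose u l : P := (l == i)%:R - (l == e)%:R * 'X_(kbase i).
have sumu (V : comNzRingType) (f : {rmorphism P -> V}) (g : I -> V) :
    \sum_(l in A) f (u l) * g l = g i - f 'X_(kbase i) * g e.
  rewrite (bigD1 i) //= (bigD1 e) /=; last by rewrite eA eq_sym.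
  rewrite big1 => [|l /andP[/andP[_ li] le]].
    rewrite /u !eqxx (negbTE ie) eq_sym (negbTE ie) mul0r mul1r subr0 sub0r rmorph1 rmorphN.
    by rewrite mul1r mulNr addr0.
  by rewrite /u (negbTE li) (negbTE le) mul0r subr0 rmorph0 mul0r.
have [|v hv] := proj1 (resolves_exact resD a0F u).
  split=> [j jA|].
    by rewrite (sumu _ idfun) !(specialize_khom resD) ?mulr0 ?subr0 ?he ?hi.
  rewrite sumu /= apery_evalX /koszul_aug hi he eqxx be /basis_wt (negbTE bi) eqxx expr0 mulr1.
  by rewrite /ap modn_small // ifN ?subrr.
have := congr1 (mcoeff 0%MM) (hv i iA).
rewrite /u eqxx (negbTE ie) mul0r subr0 mcoeffC eqxx mulr1 raddf_sum big1.
  by move/eqP; rewrite oner_eq0.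
by move=> l lA; rewrite /= rmorphM /= specialize_minimal // mulr0.
Qed.

Lemma minimal_resolution a : apery_in_face a ->
  @graded_minimal_free_resolution k m (ap m a) (@apery_ideal k m a) (fun d => #|part d|)
    (fun d => map_mx (@subst k m a) (set_mx D (part d.+1) (part d))).
Proof.
move=> aF; have [e eA [he be]] := resolves_unit resD.
have part0 := degree0_unit eA he be.
have part0_val (j : 'I_#|part 0%N|) : enum_val j = e.
  have in0 x : x \in part 0%N -> x = e by rewrite part0 inE => /eqP.
  exact: in0 (enum_valP j).
have ex := resolves_exact resD aF.
have hom i j : specialize a D i j != 0 -> khom i = (khom j).+1 := @specialize_hom A D resD a i j.
have mapE B C : map_mx (@subst k m a) (set_mx D B C) = set_mx (specialize a D) B C.
  by apply/matrixP => i j; rewrite !mxE.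
split.
- by rewrite part0 cards1.
- move=> p; rewrite mapE.
  have -> : (p \in @apery_ideal k m a) = (@apery_eval k n a p == 0) by [].
  have := degree0_exact ex hom (@koszul_aug_eq0 a) (fun=> p).
  rewrite {1}part0 big_set1 /koszul_aug he eqxx be /basis_wt eqxx expr0 mulr1 => h.
  split=> [/eqP/h[v hv]|[u hu]].
    exists (\row_l v (enum_val l)); apply/matrixP => i j; rewrite [i]ord1 [RHS]mxE.
    rewrite (@mul_set_mx _ _ _ _ _ _ v) => [|l]; last by rewrite mxE.
    by rewrite -hv // enum_valP.
  apply/eqP/h; exists (spread u) => j jp.
  have /matrixP/(_ 0 (enum_rank_in jp j)) := hu; rewrite [RHS]mxE => <-.
  rewrite (@mul_set_mx _ _ _ _ _ _ (spread u)) => [|l]; last by rewrite spread_enum_val.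
  by rewrite enum_rankK_in.
- move=> d u; rewrite !mapE; apply: set_mx_exact => f.
  exact: (degree_exact ex hom (@koszul_aug_eq0 a)).
- move=> d i j; rewrite mapE mxE; apply: specialize_minimal => //.
    by have := enum_valP i; rewrite inE => /andP[].
  by have := enum_valP j; rewrite inE => /andP[].
(* The shifts are the internal Koszul degrees; the only generator in degree 0 is [e_0], of weight
   0. *)
- exists (fun d i => koszul_wt a (enum_val i)); split.
    by move=> j; rewrite part0_val /koszul_wt kwt_khom0 // be /basis_wt eqxx.
  move=> d i j mon; rewrite !mxE => /subst_msupp[mon' hmon ->].
  by have [_ /(_ a aF) [-> _]] := resolves_homogeneous resD hmon.
Qed.
End Resolution.
End Minimization.

Theorem theorem4p4 (k : fieldType) (R : realFieldType) (m : nat)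
    (F : 'rV[R]_(m.-1) -> Prop) :
  (2 <= m)%N -> kunz_face F ->
  exists (r : nat -> nat) (N : forall d : nat, 'M[formal_ring k m]_(r d.+1, r d)),
    forall (S : pred nat) (a : nat -> nat),
      numerical_semigroup S -> multiplicity S m -> apery_coords S m a ->
      relint F (apery_vec R m a) ->
      @graded_minimal_free_resolution k m (ap m a) (@apery_ideal k m a) r
        (fun d => map_mx (@subst k m a) (N d)).
Proof.
case: m F => [//|n] F _ faceF.
(* The reference [a0] is chosen from [F] before any [S] is given, so the matrices do not depend on
   [S]. *)
have [[a0 a0F]|none] := classic (exists a0, apery_in_face F a0).
  have [A [D [resD minD]]] := minimal_resolves k faceF a0F.
  exists (fun d => #|degree_part A (@khom n.+1 n) d|).
  exists (fun d => set_mx D (degree_part A (@khom n.+1 n) d.+1) (degree_part A (@khom n.+1 n) d)).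
  by move=> S a nsS mS apS rS; apply: (minimal_resolution a0F resD minD); exists S.
(* Placeholder of rank 0: no semigroup meets the hypotheses. *)
exists (fun=> 0%N), (fun=> 0) => S a nsS mS apS rS.
by case: none; exists a, S.
Qed.
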